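(* Let $F$ be a graded field, $D$ a graded central division algebra over $F$ and $(\omega,d)$ the factor set of $\Gamma_D/\Gamma_F$ in $D_0$ described in the context. Assume that there are: 1. a Kummer field extension $M$ of $F_0$ in $D_0$, and a subgroup $R$ of $\Gamma_D/\Gamma_F$, acting trivially on $M$, such that $F_0$ contains a primitive $N$-th root of unity, where $N=\exp(Gal(M/F_0))\cdot\exp(R)$; 2. a cocycle $d'\in Z^2(R,KUM(M/F_0))_{sym}$ and a map $\omega':R\to Aut(D_0)$ such that $(\omega',i_*d')$ is a factor set of $R$ in $D_0$ cohomologous to $res^{\Gamma_D/\Gamma_F}_R(\omega,d)$ and such that $\omega'_{\bar\gamma}(a)=a$ for all $a\in M$ and $\bar\gamma\in R$. Then there exists a Kummer graded subfield $K$ of $D$ such that: 1. $K_0=M$, $\Gamma_K/\Gamma_F=R$, and 2. $e_*([d'])=[\alpha_K]$.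
   Context: Graded objects. Gradings are by torsion-free (totally ordered) abelian groups. For a graded ring $R=\bigoplus_\gamma R_\gamma$, $\Gamma_R$ is its support $\{\gamma:R_\gamma\ne0\}$, $gr(x)=\gamma$ for $0\ne x\in R_\gamma$, and $R^*$ is the group of units. A graded field (resp. graded division algebra) is a commutative graded ring (resp. graded ring) in which every nonzero homogeneous element is invertible; its units are exactly the nonzero homogeneous elements. A graded central division algebra over a graded field $F$ is a graded division algebra $D$ with center $F$ (as graded ring) and $[D:F]<\infty$. A graded subfield of $D$ is a commutative graded subring containing $F$ that is a graded field. $\Gamma_D/\Gamma_F$ acts on $Z(D_0)$ via $\theta_D:\Gamma_D/\Gamma_F\to Gal(Z(D_0)/F_0)$, $\theta_D(gr(x)+\Gamma_F)(a)=xax^{-1}$ for $x\in D^*$. Factor sets. Let $A$ be a central simple algebra over a field $L$ and $H$ a finite group acting on $L$ by automorphisms. For $c\in A^*$, $Inn(c)(a)=cac^{-1}$. A factor set of $H$ in $A$ is a pair of maps $\omega:H\to Aut(A)$ (ring automorphisms), $f:H\times H\to A^*$ with $\omega_\sigma|_L=\sigma$, $\omega_\sigma\omega_\tau=Inn(f(\sigma,\tau))\omega_{\sigma\tau}$, and $f(\sigma,\tau)f(\sigma\tau,\mu)=\omega_\sigma(f(\tau,\mu))f(\sigma,\tau\mu)$. Two factor sets $(\omega,f)$ and $(\omega',f')$ are cohomologous if there are $a_\sigma\in A^*$ $(\sigma\in H)$ with $\omega'_\sigma=Inn(a_\sigma)\omega_\sigma$ and $f'(\sigma,\tau)=a_\sigma\omega_\sigma(a_\tau)f(\sigma,\tau)a_{\sigma\tau}^{-1}$.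 Here $A=D_0$, $L=Z(D_0)$, with the action of (subgroups of) $\Gamma_D/\Gamma_F$ via $\theta_D$. The factor set $(\omega,d)$. Let $H=\Gamma_D/\Gamma_F$ (a finite abelian group). Fix a basis $(\bar\delta_i=\delta_i+\Gamma_F)_{1\le i\le r}$ of $H$ (so $H$ is the direct sum of the cyclic groups generated by the $\bar\delta_i$), let $q_i$ be the order of $\bar\delta_i$, and $I=\{(m_1,\dots,m_r)\in\mathbb N^r:0\le m_i<q_i\}$. Fix $x_i\in F^*$ with $gr(x_i)=q_i\delta_i$ and $z_i\in D^*$ with $gr(z_i)=\delta_i$. For $\bar m\in I$ put $\bar m\bar\delta=\sum m_i\bar\delta_i$ and $z_{\bar m\bar\delta}=z^{\bar m}=z_1^{m_1}\cdots z_r^{m_r}$; every $\bar\gamma\in H$ is uniquely of the form $\bar m\bar\delta$. Let $\omega_{\bar\gamma}\in Aut(D_0)$ be $a\mapsto z_{\bar\gamma}az_{\bar\gamma}^{-1}$. For $\bar m,\bar n\in I$ write $m_i+n_i=\beta_i+t_iq_i$ with $0\le\beta_i<q_i$, $t_i\in\mathbb N$; put $h(\bar m\bar\delta,\bar n\bar\delta)=\prod_i x_i^{t_i}\in F^*$ and $d(\bar\gamma,\bar\gamma')=z_{\bar\gamma}z_{\bar\gamma'}z_{\bar\gamma+\bar\gamma'}^{-1}h(\bar\gamma,\bar\gamma')^{-1}\in D_0^*$. The pair $(\omega,d)$ is a factor set of $H$ in $D_0$; $res^H_R(\omega,d)$ is its restriction to a subgroup $R$. Kummer data. A finite-dimensional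 graded field extension $K/F$ is abelian if $Frac(K)/Frac(F)$ is abelian Galois ($Gal(K/F)$ is then its Galois group); it is Kummer if moreover $F_0$ contains a primitive $m$-th root of unity, $m$ the exponent of $Gal(K/F)$. Then $KUM(K/F)=\{x\in K^*:x^m\in F\}$, $kum(K/F)=KUM(K/F)/F^*$, and similarly for ordinary Kummer field extensions such as $K_0/F_0$ and $M/F_0$. For a Kummer graded subfield $K$ of $D$ there is an exact sequence of trivial $\Gamma_K/\Gamma_F$-modules $$1\to kum(K_0/F_0)\stackrel{\phi}{\to}kum(K/F)\stackrel{\psi}{\to}\Gamma_K/\Gamma_F\to0,$$ $\phi(aF_0^* )=aF^*$, $\psi(aF^* )=gr(a)+\Gamma_F$; $\alpha_K\in Z^2(\Gamma_K/\Gamma_F,kum(K_0/F_0))_{sym}$ denotes a 2-cocycle representing this abelian group extension and $[\alpha_K]$ its class. The subscript $sym$ denotes symmetric 2-cocycles (resp. classes of these). $M$ and $KUM(M/F_0)$ are regarded as carrying the trivial $R$-action (''$R$ acts trivially on $M$''). $e:KUM(M/F_0)\to kum(M/F_0)$ is the canonical surjection, $e_*:H^2(R,KUM(M/F_0))_{sym}\to H^2(R,kum(M/F_0))_{sym}$ the induced map, $i:KUM(M/F_0)\to D_0^*$ the inclusion and $i_*d'=i\circ d'$. *)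

(* Defs.v *)
From HB Require Import structures.
From mathcomp Require Import all_boot all_order all_algebra all_fingroup.
From mathcomp Require Import all_solvable all_field.
From mathcomp Require Import boolp classical_sets functions.

Set Implicit Arguments.
Unset Strict Implicit.
Unset Printing Implicit Defensive.

Import GRing.Theory.

Local Open Scope classical_set_scope.
Local Open Scope ring_scope.

(* All rings of the theory (D, F, D_0, F_0, M, K, ...) are subsets of one
   ambient ring D.  A grading of D is the family [gr g] of its homogeneous
   components.  For a subring S of D, the component of degree g of S is
   S `&` gr g. *)

Definition torsion_free (Gam : zmodType) : Prop :=
  forall (g : Gam) (n : nat), (0 < n)%N -> g *+ n = 0 -> g = 0.

Definition is_subring (D : nzRingType) (S : set D) : Prop :=
  [/\ S 1, forall x y, S x -> S y -> S (x - y)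
    & forall x y, S x -> S y -> S (x * y)].

Record is_grading (Gam : zmodType) (D : nzRingType) (gr : Gam -> set D) :
    Prop := IsGrading {
  gr_zero : forall g, gr g 0;
  gr_sub : forall g x y, gr g x -> gr g y -> gr g (x - y);
  gr_one : gr 0 1;
  gr_mul : forall g h x y, gr g x -> gr h y -> gr (g + h) (x * y);
  gr_span : forall x : D, exists (s : seq Gam) (c : Gam -> D),
    (forall g, gr g (c g)) /\ x = \sum_(g <- s) c g;
  gr_indep : forall (s : seq Gam) (c : Gam -> D), uniq s ->
    (forall g, gr g (c g)) -> \sum_(g <- s) c g = 0 ->
    forall g, g \in s -> c g = 0 }.

Definition graded_subring (Gam : zmodType) (D : nzRingType)
    (gr : Gam -> set D) (S : set D) : Prop :=
  is_subring S /\
  forall x, S x -> exists (s : seq Gam) (c : Gam -> D),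
    (forall g, (S `&` gr g) (c g)) /\ x = \sum_(g <- s) c g.

Definition gr_support (Gam : zmodType) (D : nzRingType) (gr : Gam -> set D)
    (S : set D) : set Gam :=
  [set g | exists2 x, (S `&` gr g) x & x != 0].

Definition deg0 (Gam : zmodType) (D : nzRingType) (gr : Gam -> set D)
    (S : set D) : set D := S `&` gr 0.

(* The unit group S^* of a subring S (inverses are required to lie in S). *)
Definition units (D : unitRingType) (S : set D) : set D :=
  [set x | [/\ S x, x \is a GRing.unit & S x^-1]].

Definition graded_field (Gam : zmodType) (D : unitRingType)
    (gr : Gam -> set D) (F : set D) : Prop :=
  [/\ graded_subring gr F, forall x y, F x -> F y -> x * y = y * x
    & forall g x, F x -> gr g x -> x != 0 -> units F x].

(* S is a free F-module of finite rank; [S : F] < oo.  Modules over graded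
   fields are only considered when graded, in which case they are free. *)
Definition finite_dim (D : nzRingType) (F S : set D) : Prop :=
  exists (n : nat) (b : 'I_n -> D), (forall i, S (b i)) /\
    forall x, S x -> exists! c : {ffun 'I_n -> D},
      (forall i, F (c i)) /\ x = \sum_(i < n) c i * b i.

Definition ring_center (D : nzRingType) (S : set D) : set D :=
  [set x | S x /\ forall y, S y -> x * y = y * x].

(* The whole ring D is a graded central division algebra over F. *)
Definition graded_central_division_algebra (Gam : zmodType)
    (D : unitRingType) (gr : Gam -> set D) (F : set D) : Prop :=
  [/\ is_grading gr,
      forall g x, gr g x -> x != 0 -> x \is a GRing.unit,
      F = ring_center [set: D]
    & finite_dim F [set: D]].

Definition graded_subfield (Gam : zmodType) (D : unitRingType)
    (gr : Gam -> set D) (F K : set D) : Prop :=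
  graded_field gr K /\ F `<=` K.

(* (H, cl) is a presentation of the quotient group Gam_D / Gam_F: cl is a
   group morphism from Gam_D onto H with kernel Gam_F.  H is written
   multiplicatively; the values of cl outside Gam_D are irrelevant. *)
Definition is_quotient (Gam : zmodType) (GD GF : set Gam)
    (H : finGroupType) (cl : Gam -> H) : Prop :=
  [/\ forall g h, GD g -> GD h -> cl (g + h) = (cl g * cl h)%g,
      forall s : H, exists2 g, GD g & cl g = s
    & forall g, GD g -> (cl g = 1%g <-> GF g)].

(* theta_D : Gam_D / Gam_F -> Gal (Z(D_0) / F_0).  The result, for a in
   Z(D_0), does not depend on the chosen x. *)
Definition theta (Gam : zmodType) (D : unitRingType) (gr : Gam -> set D)
    (H : finGroupType) (cl : Gam -> H) (s : H) (a : D) : D :=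
  let x := xget 1 [set x | x \is a GRing.unit /\
                           exists2 g, gr g x & cl g = s] in
  x * a * x^-1.

(* Factor sets of a group R in A, where R acts on L = Z(A) via act.  Maps
   defined on R (resp. on A) are total functions, of which only the values on
   R (resp. on A) matter. *)

Definition is_aut (D : nzRingType) (A : set D) (w : D -> D) : Prop :=
  [/\ set_bij A A w, w 1 = 1,
      forall x y, A x -> A y -> w (x + y) = w x + w y
    & forall x y, A x -> A y -> w (x * y) = w x * w y].

Record factor_set (D : unitRingType) (A L : set D) (H : finGroupType)
    (act : H -> D -> D) (R : {group H})
    (w : H -> D -> D) (f : H -> H -> D) : Prop := FactorSet {
  fs_aut : forall s, s \in R -> is_aut A (w s);
  fs_unit : forall s t, s \in R -> t \in R -> units A (f s t);
  fs_act : forall s a, s \in R -> L a -> w s a = act s a;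
  fs_inn : forall s t a, s \in R -> t \in R -> A a ->
    w s (w t a) = f s t * w (s * t)%g a * (f s t)^-1;
  fs_cocycle : forall s t u, s \in R -> t \in R -> u \in R ->
    f s t * f (s * t)%g u = w s (f t u) * f s (t * u)%g }.

Definition fs_cohomologous (D : unitRingType) (A : set D) (H : finGroupType)
    (R : {group H}) (w : H -> D -> D) (f : H -> H -> D)
    (w' : H -> D -> D) (f' : H -> H -> D) : Prop :=
  exists a : H -> D,
    [/\ forall s, s \in R -> units A (a s),
        forall s x, s \in R -> A x -> w' s x = a s * w s x * (a s)^-1
      & forall s t, s \in R -> t \in R ->
          f' s t = a s * w s (a t) * f s t * (a (s * t)%g)^-1].

(* The factor set (omega, d) attached to a basis (cl (delta i))_i of H and
   to homogeneous elements z i of degree delta i and x i of degree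
   q_i delta i, where q_i is the order of cl (delta i). *)

Definition is_basis (H : finGroupType) (r : nat) (b : 'I_r -> H) : Prop :=
  (\big[dprod/1]_(i < r) <[b i]>)%g = [set: H]%SET.

(* The exponent vector m in I such that s is the product of the b_i^(m_i);
   it exists and is unique when b is a basis. *)
Definition coords (H : finGroupType) (r : nat) (b : 'I_r -> H) (s : H) :
    {ffun 'I_r -> nat} :=
  xget [ffun=> 0%N] [set m : {ffun 'I_r -> nat} |
    (forall i, m i < #[b i]%g)%N /\ s = (\prod_(i < r) b i ^+ m i)%g].

Definition zpow (D : unitRingType) (H : finGroupType) (r : nat)
    (b : 'I_r -> H) (z : 'I_r -> D) (s : H) : D :=
  \prod_(i < r) z i ^+ coords b s i.

Definition hfun (D : unitRingType) (H : finGroupType) (r : nat)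
    (b : 'I_r -> H) (x : 'I_r -> D) (s t : H) : D :=
  \prod_(i < r) x i ^+ ((coords b s i + coords b t i) %/ #[b i]%g).

Definition omega (D : unitRingType) (H : finGroupType) (r : nat)
    (b : 'I_r -> H) (z : 'I_r -> D) (s : H) (a : D) : D :=
  zpow b z s * a * (zpow b z s)^-1.

Definition dfun (D : unitRingType) (H : finGroupType) (r : nat)
    (b : 'I_r -> H) (x z : 'I_r -> D) (s t : H) : D :=
  zpow b z s * zpow b z t * (zpow b z (s * t)%g)^-1 * (hfun b x s t)^-1.

(* The field Q is a finite abelian Galois extension of its subfield E, and
   m is the exponent of Gal (Q / E).  The library's extensions L / k are
   types over a base field type, so Q / E is transported along an
   isomorphism f : L -> Q mapping (the image of) k onto E. *)
Definition abelian_exponent (Q : fieldType) (E : set Q) (m : nat) : Prop :=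
  exists (k : fieldType) (L : splittingFieldType k) (f : {rmorphism L -> Q}),
    [/\ bijective f,
        f @` [set y | y \in 1%VS] = E,
        galois 1 {:L},
        abelian 'Gal({:L} / 1)
      & exponent 'Gal({:L} / 1) = m].

Definition contains_prim_root (D : nzRingType) (E : set D) (n : nat) : Prop :=
  exists2 zeta, E zeta & n.-primitive_root zeta.

(* M / E is a Kummer extension of fields (inside D), and m is the exponent
   of Gal (M / E). *)
Definition kummer_field_ext (D : nzRingType) (E M : set D) (m : nat) : Prop :=
  [/\ E `<=` M,
      exists (L : fieldType) (j : {rmorphism L -> D}),
        range j = M /\ abelian_exponent (j @^-1` E) m
    & contains_prim_root E m].

(* The subfield Frac(F) of Frac(K), for F contained in the image of K in D. *)
Definition frac_sub (D : nzRingType) (F : set D) (K : idomainType)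
    (j : K -> D) : set {fraction K} :=
  [set y | exists a b : K,
     [/\ F (j a), F (j b), b != 0 & y = tofrac a / tofrac b]].

(* K is a Kummer graded subfield of D, and m is the exponent of
   Gal (K / F) = Gal (Frac(K) / Frac(F)). *)
Definition kummer_graded_subfield (Gam : zmodType) (D : unitRingType)
    (gr : Gam -> set D) (F K : set D) (m : nat) : Prop :=
  [/\ graded_subfield gr F K,
      finite_dim F K,
      exists (T : idomainType) (j : {rmorphism T -> D}),
        [/\ injective j, range j = K & abelian_exponent (frac_sub F j) m]
    & contains_prim_root (deg0 gr F) m].

Definition KUM (D : unitRingType) (E K : set D) (m : nat) : set D :=
  [set x | units K x /\ E (x ^+ m)].

(* Elements of quotient groups such as kum are honest cosets, multiplied
   elementwise. *)
Definition setmul (D : nzRingType) (A B : set D) : set D :=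
  [set x * y | x in A & y in B].

Definition coset_of_units (D : unitRingType) (E : set D) (x : D) : set D :=
  [set x * u | u in units E].

Definition kum (D : unitRingType) (E K : set D) (m : nat) : set (set D) :=
  coset_of_units E @` KUM E K m.

(* Symmetric 2-cocycles of R in a commutative group (a subset C of T with
   multiplication mul) with trivial action, and equality of their classes. *)

Definition sym_cocycle (T : Type) (mul : T -> T -> T) (C : set T)
    (H : finGroupType) (R : {group H}) (c : H -> H -> T) : Prop :=
  [/\ forall s t, s \in R -> t \in R -> C (c s t),
      forall s t u, s \in R -> t \in R -> u \in R ->
        mul (c s t) (c (s * t)%g u) = mul (c t u) (c s (t * u)%g)
    & forall s t, s \in R -> t \in R -> c s t = c t s].

(* c' = c * (b_s b_t b_{st}^-1), written without inverses. *)
Definition same_class (T : Type) (mul : T -> T -> T) (C : set T)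
    (H : finGroupType) (R : {group H}) (c c' : H -> H -> T) : Prop :=
  exists b : H -> T, (forall s, s \in R -> C (b s)) /\
    forall s t, s \in R -> t \in R ->
      mul (c' s t) (b (s * t)%g) = mul (c s t) (mul (b s) (b t)).

(* phi (a F_0^* ) = a F^* and psi (a F^* ) = gr(a) + Gam_F, the latter as a
   relation. *)
Definition phi (D : unitRingType) (F : set D) (C : set D) : set D :=
  setmul C (units F).

Definition psi (Gam : zmodType) (D : unitRingType) (gr : Gam -> set D)
    (H : finGroupType) (cl : Gam -> H) (C : set D) (s : H) : Prop :=
  exists a g, [/\ C a, gr g a & cl g = s].

(* alpha is a symmetric 2-cocycle of R = Gam_K / Gam_F in kum(K_0/F_0)
   representing the extension kum(K/F): it is obtained from a set-theoretic
   section sec of psi.  m0 and m are the exponents of Gal(K_0/F_0) and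
   Gal(K/F). *)
Definition is_alpha (Gam : zmodType) (D : unitRingType) (gr : Gam -> set D)
    (F : set D) (H : finGroupType) (cl : Gam -> H) (R : {group H})
    (K : set D) (m0 m : nat) (alpha : H -> H -> set D) : Prop :=
  sym_cocycle (@setmul D) (kum (deg0 gr F) (deg0 gr K) m0) R alpha /\
  exists sec : H -> set D,
    (forall s, s \in R -> kum F K m (sec s) /\ psi gr cl (sec s) s) /\
    forall s t, s \in R -> t \in R ->
      setmul (sec s) (sec t) = setmul (phi F (alpha s t)) (sec (s * t)%g).

(* Main.v *)
From HB Require Import structures.
Require Import Defs.
From mathcomp Require Import all_boot all_order all_algebra all_fingroup.
From mathcomp Require Import all_solvable all_field.
From mathcomp Require Import boolp classical_sets functions.

Set Implicit Arguments.
Unset Strict Implicit.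
Unset Printing Implicit Defensive.

Import GRing.Theory.
Local Open Scope classical_set_scope.
Local Open Scope ring_scope.

(** The idea. Let [a_s] be the units of [D_0] that carry [(omega', d')] to the
    restriction of [(omega, d)], and put [y_s = a_s^-1 z_s] for [s] in [R].
    Conjugation by [y_s] induces [omega'_s] on [D_0], hence is trivial on [M],
    and [y_s y_t = d'(s, t) h(s, t) y_(st)] with [h(s, t)] a homogeneous unit
    of the central subring [F].  Since [d'] and [h] are symmetric, the [y_s]
    commute with each other and with [M].  The graded subfield sought is
    [K = M F [y_s : s in R]]: its homogeneous elements are the monomials
    [a f y_s], with [a] in [M] and [f] homogeneous in [F], and the class of
    the degree of such a monomial determines [s] ([monomial_cl]).  From this,
    [K_0 = M], the support of [K] modulo that of [F] is [R], and the section
    [s |-> y_s F^*] of [psi] exhibits the classes of [d'(s, t)] modulo [F_0^*]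
    as a cocycle of the extension [kum(K / F)], so that both classes agree.

    What remains is that [K / F] is Kummer, a statement on fraction fields.
    [K] is a domain because a torsion-free abelian group can be totally
    ordered and leading components then multiply
    ([torsion_free_total_cone], [graded_division_domain]).  Kummer theory for
    [M / F_0] says that [M] is spanned over [F_0] by elements [c] such that
    [c ^ m] is in [F_0]: they are simultaneous eigenvectors of the Galois
    group ([kummer_spanned]).  So [K] is spanned over [F] by the
    [u = c y_s], and [u ^ N] is in [F] for [N = m exp(R)].  The same [u] span
    [Frac(K)] over [Frac(F)] ([frac_spanned]); as [F_0] contains a primitive
    [N]-th root of unity, [Frac(K)] is a splitting field of a product of
    separable polynomials [X^N - u^N], and each automorphism multiplies each
    [u] by an [N]-th root of unity, whence an abelian Galois group of exponent
    [e] dividing [N] ([kummer_galois]).  Finally [y_s ^ e] is fixed by the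
    Galois group, hence lies in [Frac(F)], and being homogeneous it lies
    in [F] ([frac_sub_F]). *)

(** * Total orders on torsion-free abelian groups *)

(** The cone [P] of nonnegative elements encodes a total order compatible with
    the group law. *)
Definition total_cone (Gam : zmodType) (P : set Gam) : Prop :=
  [/\ forall x y, P x -> P y -> P (x + y),
      forall x, P x -> P (- x) -> x = 0
    & forall x, P x \/ P (- x)].

(** A maximal proper cone, given by Zorn's lemma, is total: if it contains
    neither [x] nor [- x], then by maximality it contains some [- n x] and some
    [k x] with [n, k > 0], hence [n k x] and its opposite, so that [n k x = 0]. *)
Lemma torsion_free_total_cone (Gam : zmodType) :
  torsion_free Gam -> exists P : set Gam, total_cone P.
Proof.
move=> tf.
pose cone (P : set Gam) := [/\ P 0, forall x y, P x -> P y -> P (x + y)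
  & forall x, P x -> P (- x) -> x = 0].
(* the empty set is admitted so that the union of the empty chain qualifies *)
have [C Cc tot|P [Pc maxP]] := @Zorn_bigcup Gam (fun P => P = set0 \/ cone P).
  have [[A CA [a Aa]]|nC] := pselect (exists2 A, C A & A !=set0); last first.
    left; apply/seteqP; split=> // a [A CA Aa].
    by case: nC; exists A => //; exists a.
  have coneC B b : C B -> B b -> cone B.
    by move=> CB Bb; case: (Cc _ CB) => // B0; rewrite B0 in Bb.
  have common x y : (\bigcup_(X in C) X) x -> (\bigcup_(X in C) X) y ->
      exists2 B, C B & B x /\ B y.
    move=> [B CB Bx] [B' CB' By]; case: (tot _ _ CB CB') => s.
      by exists B' => //; split=> //; apply: s.
    by exists B => //; split=> //; apply: s.
  right; split.
  - by exists A => //; case: (coneC _ _ CA Aa).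
  - move=> x y Ux Uy; have [B CB [Bx By]] := common _ _ Ux Uy.
    by exists B => //; case: (coneC _ _ CB Bx) => _ H _; apply: H.
  - move=> x Ux Uy; have [B CB [Bx By]] := common _ _ Ux Uy.
    by case: (coneC _ _ CB Bx) => _ _ H; apply: H.
have {}Pc : cone P.
  case: Pc => // P0; exfalso; apply: (maxP [set 0]).
    by rewrite P0; split=> [|H]; [exact: sub0set|exact: (H 0 erefl)].
  right; split=> //=; first by move=> x y -> ->; rewrite addr0.
case: (Pc) => P0 PD Panti; exists P; split=> //.
have PMn n x : P x -> P (x *+ n).
  by move=> Px; elim: n => [|n IHn]; rewrite ?mulr0n // mulrS; apply: PD.
(* if x is not in P, maximality makes the cone P + N x degenerate *)
have neg x : ~ P x -> exists2 n, (0 < n)%N & P (- (x *+ n)).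
  move=> nPx; apply: contrapT => nneg.
  apply: (maxP [set y | exists p n, P p /\ y = p + x *+ n]).
    split=> [p Pp|sub]; first by exists p, 0%N; rewrite addr0.
    by apply: nPx; apply: sub; exists 0, 1%N; rewrite add0r.
  right; split.
  - by exists 0, 0%N; rewrite addr0.
  - move=> _ _ [p [n [Pp ->]]] [q [k [Pq ->]]].
    by exists (p + q), (n + k)%N; rewrite mulrnDr addrACA; split=> //; apply: PD.
  - move=> _ [p [n [Pp ->]]] [q [k [Pq e]]].
    have e2 : p + q = - (x *+ (n + k)).
      by apply/eqP; rewrite -addr_eq0 mulrnDr addrACA -e subrr.
    case nk : (n + k)%N e2 => [|j] e2; last first.
      by case: nneg; exists j.+1 => //; rewrite -e2; apply: PD.
    move: nk => /eqP; rewrite addn_eq0 => /andP[/eqP n0 /eqP k0].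
    move: e2; rewrite mulr0n oppr0 => /eqP; rewrite addr_eq0 => /eqP pq.
    rewrite n0 mulr0n addr0; apply: Panti => //.
    by rewrite pq opprK.
move=> x; have [|/neg[n n0 Pn]] := pselect (P x); first by left.
have [|/neg[k k0 Pk]] := pselect (P (- x)); first by right.
left; suff -> : x = 0 by [].
apply: (tf x (n * k)%N); first by rewrite muln_gt0 n0.
apply: Panti; last by rewrite mulrnA -mulNrn; apply: PMn.
by rewrite mulnC mulrnA; apply: PMn; move: Pk; rewrite mulNrn opprK.
Qed.

Lemma total_cone_max (Gam : zmodType) (P : set Gam) (s : seq Gam) :
  total_cone P -> s != [::] ->
  exists2 g0, g0 \in s & forall g, g \in s -> P (g0 - g).
Proof.
move=> [PD Pa Pt]; elim: s => // g s IHs _.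
have P0 : P 0 by case: (Pt 0); rewrite ?oppr0.
have [->|/IHs [h hs hmax]] := eqVneq s [::].
  by exists g; rewrite ?mem_head // => h; rewrite inE => /eqP->; rewrite subrr.
have [Pgh|Pgh] := Pt (g - h).
  exists g; rewrite ?mem_head // => x; rewrite inE => /orP[/eqP->|/hmax].
    by rewrite subrr.
  by move=> /(PD _ _ Pgh); rewrite subrKA.
exists h; first by rewrite inE hs orbT.
move=> x; rewrite inE => /orP[/eqP->|/hmax //].
by rewrite -opprB.
Qed.

(** * Homogeneous components *)

Lemma sum_extend (I : eqType) (V : zmodType) (s t : seq I) (c : I -> V) :
  uniq s -> uniq t -> {subset s <= t} -> (forall i, i \notin s -> c i = 0) ->
  \sum_(i <- s) c i = \sum_(i <- t) c i.
Proof.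
move=> Us Ut st c0; rewrite [RHS](bigID (mem s)) /= [X in _ + X]big1 // addr0.
rewrite -[RHS]big_filter; apply: perm_big; apply: uniq_perm => //.
  exact: filter_uniq.
by move=> i; rewrite mem_filter; case: (boolP (i \in s)) => // /st ->.
Qed.

Section Components.
Variables (Gam : zmodType) (D : nzRingType) (gr : Gam -> set D).
Hypothesis Hg : is_grading gr.

Lemma homog_add g x y : gr g x -> gr g y -> gr g (x + y).
Proof.
move=> gx gy; rewrite -[y]opprK -[- y]sub0r; apply: (gr_sub Hg) => //.
by apply: (gr_sub Hg) => //; apply: (gr_zero Hg).
Qed.

(** The family of components is a function on the whole group with finite
    support; this makes it unique, and [component] additive. *)
Definition decomposition (x : D) (c : Gam -> D) : Prop :=
  (forall g, gr g (c g)) /\ exists s, [/\ uniq s,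
    forall g, g \notin s -> c g = 0 & x = \sum_(g <- s) c g].

Lemma decomposition_exists x : exists c, decomposition x c.
Proof.
have [s [c [gc ->]]] := gr_span Hg x.
exists (fun g => c g *+ count_mem g s); split.
  move=> g; elim: (count_mem g s) => [|n IHn]; first by rewrite mulr0n;
    apply: (gr_zero Hg).
  by rewrite mulrS; apply: homog_add.
exists (undup s); split; first exact: undup_uniq.
  by move=> g; rewrite mem_undup => /count_memPn ->.
rewrite -[LHS]big_undup_iterop_count; apply: eq_bigr => g _.
by [].
Qed.

Lemma decomposition_unique x c c' :
  decomposition x c -> decomposition x c' -> c = c'.
Proof.
move=> [gc [s [Us c0 xs]]] [gc' [s' [Us' c0' xs']]].
pose t := undup (s ++ s').
have Ut : uniq t by apply: undup_uniq.
have st : {subset s <= t} by move=> g gs; rewrite mem_undup mem_cat gs.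
have st' : {subset s' <= t} by move=> g gs; rewrite mem_undup mem_cat gs orbT.
have e : \sum_(g <- t) (c g - c' g) = 0.
  rewrite sumrB -(sum_extend Us Ut st c0) -(sum_extend Us' Ut st' c0').
  by rewrite -xs -xs' subrr.
apply/funext => g; have [gt|] := boolP (g \in t).
  apply/eqP; rewrite -subr_eq0; apply/eqP.
  have := gr_indep Hg Ut _ e; apply=> //.
  by move=> h; apply: (gr_sub Hg).
rewrite mem_undup mem_cat negb_or => /andP[gs gs'].
by rewrite c0 // c0'.
Qed.

Definition component (g : Gam) (x : D) : D :=
  projT1 (cid (decomposition_exists x)) g.

Lemma component_decomposition x : decomposition x (component^~ x).
Proof. by rewrite /component; case: cid. Qed.

Lemma component_unique x c g : decomposition x c -> component g x = c g.
Proof.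
by move=> dc; rewrite (decomposition_unique dc (component_decomposition x)).
Qed.

Lemma component_homog g x : gr g (component g x).
Proof. by case: (component_decomposition x). Qed.

Lemma component_sum x : exists s, [/\ uniq s,
  forall g, g \notin s -> component g x = 0
  & x = \sum_(g <- s) component g x].
Proof. by case: (component_decomposition x). Qed.

Lemma component_id g h x :
  gr h x -> component g x = if g == h then x else 0.
Proof.
move=> hx; apply: (component_unique (c := fun g => if g == h then x else 0)).
split=> [g'|]; first by case: eqP => [->//|_]; apply: (gr_zero Hg).
exists [:: h]; split=> // [g'|]; first by rewrite inE => /negbTE ->.
by rewrite big_seq1 eqxx.
Qed.

Lemma component_is_zmod_morphism g : zmod_morphism (component g).
Proof.
move=> x y; apply: (component_unique
  (c := fun g => component g x - component g y)).
split=> [g'|]; first by apply: (gr_sub Hg); apply: component_homog.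
have [s [Us s0 xs]] := component_sum x; have [t [Ut t0 xt]] := component_sum y.
have Uu : uniq (undup (s ++ t)) by apply: undup_uniq.
exists (undup (s ++ t)); split=> //.
  move=> h; rewrite mem_undup mem_cat negb_or => /andP[/s0-> /t0->].
  by rewrite subr0.
have su : {subset s <= undup (s ++ t)}.
  by move=> h hs; rewrite mem_undup mem_cat hs.
have tu : {subset t <= undup (s ++ t)}.
  by move=> h ht; rewrite mem_undup mem_cat ht orbT.
by rewrite sumrB -(sum_extend Us Uu su s0) -(sum_extend Ut Uu tu t0) -xs -xt.
Qed.

HB.instance Definition _ g :=
  GRing.isZmodMorphism.Build D D (component g) (component_is_zmod_morphism g).

Lemma component_mull h a g x :
  gr h a -> component (h + g) (a * x) = a * component g x.
Proof.
move=> ha; have [s [Us s0 {1}->]] := component_sum x.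
rewrite mulr_sumr raddf_sum /=.
under eq_bigr => g' _.
  rewrite (component_id _ (gr_mul Hg ha (component_homog g' x))).
  rewrite (inj_eq (addrI h)); over.
have [gs|gs] := boolP (g \in s).
  rewrite (bigD1_seq g) //= eqxx big1 ?addr0 // => g'.
  by rewrite eq_sym => /negbTE ->.
rewrite s0 // mulr0 big1_seq // => g' /andP[_ g's].
by case: eqP gs => // ->; rewrite g's.
Qed.

Lemma component_mulr h a g x :
  gr h a -> component (g + h) (x * a) = component g x * a.
Proof.
move=> ha; have [s [Us s0 {1}->]] := component_sum x.
rewrite mulr_suml raddf_sum /=.
under eq_bigr => g' _.
  rewrite (component_id _ (gr_mul Hg (component_homog g' x) ha)).
  rewrite (inj_eq (addIr h)); over.
have [gs|gs] := boolP (g \in s).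
  rewrite (bigD1_seq g) //= eqxx big1 ?addr0 // => g'.
  by rewrite eq_sym => /negbTE ->.
rewrite s0 // mul0r big1_seq // => g' /andP[_ g's].
by case: eqP gs => // ->; rewrite g's.
Qed.

Lemma component_neq0 x : x != 0 -> exists g, component g x != 0.
Proof.
move=> x0; apply: contrapT => nex; have [s [_ _ xs]] := component_sum x.
move: x0; rewrite xs big1 ?eqxx // => g _; apply/eqP; apply: contrapT => /negP cg.
by apply: nex; exists g.
Qed.

Lemma homog_degree_unique g h x : gr g x -> gr h x -> x != 0 -> g = h.
Proof.
move=> gx hx x0; apply/eqP; move: x0; apply: contraNT => gh.
by have := component_id g gx; rewrite eqxx (component_id g hx) (negbTE gh) => ->.
Qed.

Lemma homog_prod I (s : seq I) (d : I -> Gam) (F : I -> D) :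
  (forall i, gr (d i) (F i)) -> gr (\sum_(i <- s) d i) (\prod_(i <- s) F i).
Proof.
move=> H; elim: s => [|i s IHs]; rewrite ?big_nil ?big_cons; first exact: (gr_one Hg).
exact: (gr_mul Hg).
Qed.

Lemma homog_exp g x n : gr g x -> gr (g *+ n) (x ^+ n).
Proof.
move=> gx; elim: n => [|n IHn]; first exact: (gr_one Hg).
by rewrite mulrS exprS; apply: (gr_mul Hg).
Qed.

End Components.

(** * Graded division rings have no zero divisors *)

Section GradedDivision.
Variables (Gam : zmodType) (D : unitRingType) (gr : Gam -> set D).
Hypotheses (Hg : is_grading gr)
  (gr_unit : forall g x, gr g x -> x != 0 -> x \is a GRing.unit).

Lemma homog_inv g x : gr g x -> x \is a GRing.unit -> gr (- g) x^-1.
Proof.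
move=> gx ux; have e := component_mull Hg (- g) (x^-1) gx.
rewrite mulrV // subrr (component_id Hg _ (gr_one Hg)) eqxx in e.
rewrite -[x^-1]mulr1 e mulKr //; exact: component_homog.
Qed.

(** The component of [x y] in the sum of the leading degrees of [x] and [y] is
    the product of two homogeneous units. *)
Lemma graded_division_domain : torsion_free Gam ->
  forall x y : D, x * y = 0 -> x = 0 \/ y = 0.
Proof.
move=> /torsion_free_total_cone[P cP] x y xy0.
apply: contrapT => /not_orP[/eqP x0 /eqP y0].
have lead u : u != 0 -> exists2 g0, component Hg g0 u != 0 &
    forall g, component Hg g u != 0 -> P (g0 - g).
  move=> u0; have [s [Us s0 us]] := component_sum Hg u.
  pose t := [seq g <- s | component Hg g u != 0].
  have memt g : component Hg g u != 0 -> g \in t.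
    move=> cg; rewrite mem_filter cg /=; move: cg.
    by apply: contraNT => /s0 ->.
  have [|g0 g0t max] := @total_cone_max _ _ t cP.
    have [g /memt] := component_neq0 Hg u0.
    by case: t {memt}.
  exists g0; first by move: g0t; rewrite mem_filter => /andP[].
  by move=> g /memt /max.
have [g0 xg0 maxg] := lead x x0; have [h0 yh0 maxh] := lead y y0.
case: cP => PD Pa Pt.
have : component Hg (g0 + h0) (x * y) = component Hg g0 x * component Hg h0 y.
  have [s [Us s0 {1}->]] := component_sum Hg x.
  rewrite mulr_suml raddf_sum /=.
  have term g : component Hg (g0 + h0) (component Hg g x * y) =
      if g == g0 then component Hg g0 x * component Hg h0 y else 0.
    have -> : g0 + h0 = g + (g0 - g + h0) by rewrite addrA subrKC.
    rewrite component_mull; last exact: component_homog.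
    case: eqP => [->|/eqP gg0]; first by rewrite subrr add0r.
    have [->|cg] := eqVneq (component Hg g x) 0; first by rewrite mul0r.
    have [->|ch] := eqVneq (component Hg (g0 - g + h0) y) 0; first by rewrite mulr0.
    case/eqP: gg0; apply/eqP; rewrite eq_sym -subr_eq0; apply/eqP.
    apply: Pa; first exact: maxg.
    by have := maxh _ ch; rewrite opprD addrCA subrr addr0.
  rewrite (eq_bigr _ (fun g _ => term g)).
  have g0s : g0 \in s by apply: contraNT xg0 => /s0 ->.
  by rewrite (bigD1_seq g0) //= eqxx big1 ?addr0 // => g /negbTE ->.
rewrite xy0 raddf0 => /esym e.
have ux := gr_unit (component_homog Hg g0 x) xg0.
by move: yh0; rewrite -(mulKr ux (component Hg h0 y)) e mulr0 eqxx.
Qed.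

End GradedDivision.

(** * Spanning families and free subfamilies *)

Definition lin_span (A : nzRingType) (E : set A) (n : nat) (b : 'I_n -> A) :
    set A :=
  [set x | exists c : 'I_n -> A,
     (forall i, E (c i)) /\ x = \sum_(i < n) c i * b i].

(** As long as some relation has a coefficient equal to [1], the corresponding
    vector is redundant.  The set [G] of vectors allowed in the family is a
    parameter, because over a graded field a relation can be normalized only
    between homogeneous vectors. *)
Lemma free_subfamily (A : nzRingType) (E G : set A) : is_subring E ->
  (forall n (b c : 'I_n -> A), (forall i, G (b i)) -> (forall i, E (c i)) ->
     (exists i, c i != 0) -> \sum_(i < n) c i * b i = 0 ->
     exists (c' : 'I_n -> A) i0,
       [/\ forall i, E (c' i), c' i0 = 1 & \sum_(i < n) c' i * b i = 0]) ->
  forall n (b : 'I_n -> A), (forall i, G (b i)) ->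
  exists p (b' : 'I_p -> A), [/\ forall i, G (b' i),
    lin_span E b' = lin_span E b
  & forall c, (forall i, E (c i)) -> \sum_(i < p) c i * b' i = 0 ->
      forall i, c i = 0].
Proof.
move=> [E1 EB EM] dep; elim=> [|n IHn] b Gb.
  by exists 0%N, b; split=> // c _ _ [].
have E0 : E 0 by rewrite -(subrr 1); apply: EB.
have [fr|] := pselect (forall c : 'I_n.+1 -> A, (forall i, E (c i)) ->
  \sum_(i < n.+1) c i * b i = 0 -> forall i, c i = 0).
  by exists n.+1, b.
move=> /existsNP[c /not_implyP[Ec /not_implyP[cb /existsNP[i0 /eqP ci0]]]].
have [|c' [i1 [Ec' c'1 c'b]]] := dep _ b c Gb Ec _ cb; first by exists i0.
have [p [b' [Gb' sb' fb']]] := IHn (fun i => b (lift i1 i)) (fun i => Gb _).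
exists p, b'; split=> //; rewrite sb'; apply/seteqP; split=> x [a [Ea ->]].
  exists (fun j => if unlift i1 j is Some i then a i else 0); split.
    by move=> j; case: unliftP.
  rewrite (bigD1_ord i1) //= unlift_none mul0r add0r.
  by apply: eq_bigr => i _; rewrite liftK.
exists (fun i => a (lift i1 i) - a i1 * c' (lift i1 i)); split.
  by move=> i; apply: EB => //; apply: EM.
move: c'b; rewrite !(bigD1_ord i1) //= c'1 mul1r => /eqP.
rewrite addr_eq0 => /eqP ->; rewrite mulrN mulr_sumr addrC -sumrB.
by apply: eq_bigr => i _; rewrite mulrBl mulrA.
Qed.

(** * Subfields and commutative subdomains as types *)

Definition is_subfield (Q : fieldType) (E : set Q) : Prop :=
  is_subring E /\ forall x, E x -> E x^-1.

Section SubfieldType.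
Variables (Q : fieldType) (E : set Q).
Hypothesis HE : is_subfield E.

(** The proof is an argument so that the closure instances, which depend on
    it, can be inferred from the predicate. *)
Definition subfield_pred (_ : is_subfield E) : {pred Q} := fun x => `[<E x>].
Local Notation S := (subfield_pred HE).

Let S_divring : divring_closed S.
Proof.
have [[E1 EB EM] EV] := HE.
have SE x : (x \in S) = `[<E x>] by [].
split=> [|x y|x y]; rewrite !SE; first exact/asboolP.
- by move=> /asboolP Ex /asboolP Ey; apply/asboolP/EB.
- by move=> /asboolP Ex /asboolP Ey; apply/asboolP/EM => //; apply: EV.
Qed.

HB.instance Definition _ := GRing.isDivringClosed.Build Q S S_divring.

Definition subfield_type : Type := {x : Q | x \in S}.
HB.instance Definition _ := [isSub for (@proj1_sig Q _ : subfield_type -> Q)].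
HB.instance Definition _ := [Choice of subfield_type by <:].
HB.instance Definition _ :=
  [SubChoice_isSubIntegralDomain of subfield_type by <:].
HB.instance Definition _ :=
  [SubIntegralDomain_isSubField of subfield_type by <:].

Definition subfield_fieldType : fieldType := subfield_type.
Definition subfield_val : {rmorphism subfield_fieldType -> Q} :=
  val : subfield_type -> Q.

Lemma subfield_valP a : E (subfield_val a).
Proof. by case: a => x Sx; apply/asboolP. Qed.

Lemma subfield_val_surj x : E x -> exists a, subfield_val a = x.
Proof.
move=> Ex; have Sx : x \in S by apply/asboolP.
by exists (exist _ x Sx).
Qed.
End SubfieldType.

Section SubdomainType.
Variables (D : nzRingType) (K : set D).

Definition is_comm_subdomain : Prop :=
  [/\ is_subring K, forall x y, K x -> K y -> x * y = y * x
    & forall x y, K x -> K y -> x * y = 0 -> x = 0 \/ y = 0].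

Hypothesis HK : is_comm_subdomain.

Definition subdomain_pred (_ : is_comm_subdomain) : {pred D} :=
  fun x => `[<K x>].
Local Notation S := (subdomain_pred HK).

Let S_subring : subring_closed S.
Proof.
have [[K1 KB KM] _ _] := HK.
have SE x : (x \in S) = `[<K x>] by [].
split=> [|x y|x y]; rewrite !SE; first exact/asboolP.
- by move=> /asboolP Kx /asboolP Ky; apply/asboolP/KB.
- by move=> /asboolP Kx /asboolP Ky; apply/asboolP/KM.
Qed.

HB.instance Definition _ := GRing.isSubringClosed.Build D S S_subring.

Definition subdomain_type : Type := {x : D | x \in S}.
HB.instance Definition _ := [isSub for (@proj1_sig D _ : subdomain_type -> D)].
HB.instance Definition _ := [Choice of subdomain_type by <:].
HB.instance Definition _ := [SubChoice_isSubNzRing of subdomain_type by <:].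

Let subdomain_mulC : commutative (@GRing.mul subdomain_type).
Proof.
have [_ KC _] := HK.
move=> [x Sx] [y Sy]; apply: val_inj; rewrite /= KC //; exact/asboolP.
Qed.

HB.instance Definition _ :=
  GRing.PzRing_hasCommutativeMul.Build subdomain_type subdomain_mulC.

(** Units are those of the subring itself: an element of [K] may be invertible
    in [D] with an inverse outside [K]. *)
Let subdomain_unit : {pred subdomain_type} :=
  fun x => `[<exists y, y * x = 1>].
Let subdomain_inv (x : subdomain_type) : subdomain_type :=
  if pselect (exists y, y * x = 1) is left e then projT1 (cid e) else x.

Let subdomain_mulVx : {in subdomain_unit, left_inverse 1 subdomain_inv *%R}.
Proof.
move=> x /asboolP ex; rewrite /subdomain_inv; case: pselect => // e.
by case: (cid e).
Qed.
Let subdomain_unitPl x y : y * x = 1 -> subdomain_unit x.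
Proof. by move=> yx; apply/asboolP; exists y. Qed.
Let subdomain_inv_out : {in [predC subdomain_unit], subdomain_inv =1 id}.
Proof.
move=> x; rewrite inE => /asboolPn nex.
by rewrite /subdomain_inv; case: pselect.
Qed.

HB.instance Definition _ := GRing.ComNzRing_hasMulInverse.Build subdomain_type
  subdomain_mulVx subdomain_unitPl subdomain_inv_out.

Let subdomain_integral : GRing.integral_domain_axiom subdomain_type.
Proof.
have [_ _ Kdom] := HK.
move=> [x Sx] [y Sy] /(congr1 val) /= xy0.
have [||e|e] := Kdom x y _ _ xy0; try exact/asboolP.
  by rewrite -val_eqE /= e eqxx.
by rewrite -[X in _ || X]val_eqE /= e eqxx orbT.
Qed.

HB.instance Definition _ :=
  GRing.ComUnitRing_isIntegral.Build subdomain_type subdomain_integral.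

Definition subdomain_idomainType : idomainType := subdomain_type.
Definition subdomain_val : {rmorphism subdomain_idomainType -> D} :=
  val : subdomain_type -> D.

Lemma subdomain_valP x : K (subdomain_val x).
Proof. by case: x => x Sx; apply/asboolP. Qed.

Lemma range_subdomain_val : range subdomain_val = K.
Proof.
apply/seteqP; split=> [_ [x _ <-]|x Kx]; first exact: subdomain_valP.
have Sx : x \in S by apply/asboolP.
by exists (exist _ x Sx).
Qed.

Lemma subdomain_val_inj : injective subdomain_val.
Proof. exact: val_inj. Qed.
End SubdomainType.

(** * A field with a basis over a subfield *)

(** A copy of [Q] that remembers a finite basis over [k]: it carries the
    structure of a finite extension of [k]. *)
Definition based_field (k Q : fieldType) (iota : {rmorphism k -> Q}) (n : nat)
    (b : 'I_n -> Q)
    (basis : forall x, exists! c : 'rV[k]_n, x = \sum_i iota (c 0 i) * b i) :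
    Type := Q.

Section BasedField.
Variables (k Q : fieldType) (iota : {rmorphism k -> Q}) (n : nat).
Variables (b : 'I_n -> Q).
Hypothesis basis :
  forall x, exists! c : 'rV[k]_n, x = \sum_i iota (c 0 i) * b i.

Local Notation L := (based_field basis).

HB.instance Definition _ := GRing.Field.on L.

Definition based_scale (a : k) (x : L) : L := iota a * (x : Q).

Let scaleA a c x : based_scale a (based_scale c x) = based_scale (a * c) x.
Proof. by rewrite /based_scale rmorphM mulrA. Qed.
Let scale1 : left_id 1 based_scale.
Proof. by move=> x; rewrite /based_scale rmorph1 mul1r. Qed.
Let scaleDr : right_distributive based_scale +%R.
Proof. by move=> a x y; rewrite /based_scale mulrDr. Qed.
Let scaleDl x : {morph based_scale^~ x : a c / a + c}.
Proof. by move=> a c; rewrite /based_scale rmorphD mulrDl. Qed.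

HB.instance Definition _ := GRing.Zmodule_isLmodule.Build k L
  scaleA scale1 scaleDr scaleDl.

Let scaleAl (a : k) (x y : L) : a *: (x * y) = a *: x * y.
Proof. exact: mulrA. Qed.

HB.instance Definition _ := GRing.Lmodule_isLalgebra.Build k L scaleAl.
HB.instance Definition _ := GRing.Lalgebra_isComAlgebra.Build k L.

Lemma based_scaleE (a : k) (x : L) : a *: x = iota a * (x : Q).
Proof. by []. Qed.

Let findim : vector_axiom_def n L.
Proof.
pose v2r (x : L) : 'rV[k]_n := projT1 (cid (basis x)).
pose r2v (c : 'rV[k]_n) : L := \sum_i iota (c 0 i) * b i.
have v2rK : cancel v2r r2v by move=> x; rewrite /v2r; case: cid => c [/= ].
have r2vK : cancel r2v v2r.
  move=> c; rewrite /v2r; case: cid => c' [/= e u].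
  by rewrite -(u c).
exists v2r; last by exists r2v.
move=> a x y; apply: (can_inj r2vK); rewrite v2rK /r2v.
under eq_bigr do rewrite !mxE rmorphD rmorphM mulrDl -mulrA.
by rewrite big_split -mulr_sumr /= -!/(r2v _) !v2rK.
Qed.

HB.instance Definition _ := Lmodule_hasFinDim.Build k L findim.

Definition based_fieldExt : fieldExtType k := L.
End BasedField.

Lemma lin_span_basis (Q : fieldType) (E : set Q) (n : nat) (u : 'I_n -> Q)
    (HE : is_subfield E) :
  exists p (b : 'I_p -> Q), lin_span E b = lin_span E u /\
    forall x, lin_span E u x -> exists! c : 'rV[subfield_fieldType HE]_p,
      x = \sum_i subfield_val HE (c 0 i) * b i.
Proof.
have [subE EV] := HE; have [E1 EB EM] := subE.
have [|p [b [_ span_b free_b]]] := @free_subfamily Q E setT subE _ n u (fun=> I).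
  move=> q b c _ Ec [i0 ci0] cb; exists (fun i => (c i0)^-1 * c i), i0; split.
  - by move=> i; apply: EM => //; apply: EV.
  - by rewrite mulVf.
  - by under eq_bigr do rewrite -mulrA; rewrite -mulr_sumr cb mulr0.
exists p, b; split=> // x; rewrite -span_b => -[c [Ec ->]].
have /choice[a Ha] : forall i, exists a, subfield_val HE a = c i.
  by move=> i; apply: subfield_val_surj.
exists (\row_i a i); split; first by apply: eq_bigr => i _; rewrite mxE Ha.
move=> d e; apply/rowP => i; rewrite mxE; apply: (fmorph_inj (subfield_val HE)).
apply/eqP; rewrite -subr_eq0; apply/eqP; rewrite Ha.
apply: (free_b (fun i => c i - subfield_val HE (d 0 i))).
  by move=> j; apply: EB => //; apply: subfield_valP.
by under eq_bigr do rewrite mulrBl; rewrite sumrB e subrr.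
Qed.

(** * Kummer theory of fields *)

Lemma prim_root_exp_eq (A : fieldType) (N : nat) (z x y : A) :
  N.-primitive_root z -> x ^+ N = y ^+ N -> exists j : 'I_N, x = z ^+ j * y.
Proof.
move=> pz exy; have N0 := prim_order_gt0 pz.
have [y0|y0] := eqVneq y 0.
  exists (Ordinal N0); rewrite y0 mulr0; apply/eqP.
  by move: exy; rewrite y0 expr0n gtn_eqF // => /eqP; rewrite expf_eq0 N0.
have /(prim_rootP pz)[j ej] : (x / y) ^+ N = 1.
  by rewrite expr_div_n exy divff // expf_neq0.
by exists j; rewrite -ej divfK.
Qed.

Lemma Xn_sub_expE (A : fieldType) (N : nat) (z y : A) :
  N.-primitive_root z -> y != 0 ->
  'X^N - (y ^+ N)%:P = \prod_(x <- [seq z ^+ j * y | j <- iota 0 N]) ('X - x%:P)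
  /\ separable_poly ('X^N - (y ^+ N)%:P).
Proof.
move=> pz y0; have N0 := prim_order_gt0 pz.
set rs := map _ _.
have Urs : uniq rs.
  rewrite map_inj_in_uniq ?iota_uniq // => i j.
  rewrite !mem_iota !add0n /= => iN jN /(mulIf y0) /eqP.
  by rewrite (eq_prim_root_expr pz) !modn_small // => /eqP.
have E : 'X^N - (y ^+ N)%:P = \prod_(x <- rs) ('X - x%:P).
  rewrite [LHS](@all_roots_prod_XsubC _ _ rs).
  - by rewrite (monicP (monicXnsubC _ N0)) scale1r.
  - by rewrite size_XnsubC // size_map size_iota.
  - apply/allP => _ /mapP[j _ ->]; rewrite /root !hornerE.
    by rewrite exprMn exprAC (prim_expr_order pz) expr1n mul1r subrr.
  - by rewrite uniq_rootsE.
by rewrite E separable_prod_XsubC.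
Qed.

(** The polynomial is the product of the [X^N - u^N] over the nonzero [u]. *)
Lemma kummer_splitting (k : fieldType) (L : fieldExtType k) (N : nat) (z : L)
    (us : seq L) : N.-primitive_root z -> <<us>>%VS = {:L}%VS ->
  (forall u, u \in us -> u ^+ N \in 1%VS) -> SplittingField.axiom L.
Proof.
move=> pz sus pus; have N0 := prim_order_gt0 pz.
pose vs := [seq u <- us | u != 0].
have fE : {in vs, forall u, 'X^N - (u ^+ N)%:P =
   \prod_(x <- [seq z ^+ j * u | j <- iota 0 N]) ('X - x%:P)}.
  by move=> u; rewrite mem_filter => /andP[u0 _]; case: (Xn_sub_expE pz u0).
exists (\prod_(u <- vs) ('X^N - (u ^+ N)%:P)).
  rewrite big_seq; apply: rpred_prod => u.
  rewrite mem_filter => /andP[_ /pus uN].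
  by rewrite rpredB ?rpredX ?polyOverX ?polyOverC.
exists (flatten [seq [seq z ^+ j * u | j <- iota 0 N] | u <- vs]).
  by rewrite big_flatten big_map big_seq (eq_bigr _ fE) -big_seq eqpxx.
apply/eqP; rewrite eqEsubv subvf -sus; apply/span_subvP => u uus.
have [->|u0] := eqVneq u 0; first by rewrite mem0v.
apply: seqv_sub_adjoin; apply/flattenP; exists [seq z ^+ j * u | j <- iota 0 N].
  by apply: map_f; rewrite mem_filter u0.
by apply/mapP; exists 0%N; rewrite ?mem_iota // expr0 mul1r.
Qed.

(** An automorphism [g] acts on each [y] such that [y ^ N] is in the base field
    by a root of unity that is itself fixed, so [g ^ i] acts by its [i]-th
    power.  This gives commutation, the bound on the exponent [e], and the
    invariance of [y ^ e]. *)
Lemma kummer_galois (k : fieldType) (L : splittingFieldType k) (N : nat) (z : L)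
    (us : seq L) : N.-primitive_root z -> z \in 1%VS -> <<us>>%VS = {:L}%VS ->
  (forall u, u \in us -> u ^+ N \in 1%VS) ->
  [/\ galois 1 {:L}, abelian 'Gal({:L} / 1),
      (exponent 'Gal({:L} / 1) %| N)%N
    & forall y : L, y ^+ N \in 1%VS -> y ^+ exponent 'Gal({:L} / 1) \in 1%VS].
Proof.
move=> pz z1 sus pus; have N0 := prim_order_gt0 pz.
have gal1 : galois 1 {:L}.
  rewrite /galois subvf normalFieldf andbT /=.
  have -> : {:L}%VS = <<1 & us>>%VS.
    apply/eqP; rewrite eqEsubv subvf andbT -sus; apply/span_subvP => u.
    exact: seqv_sub_adjoin.
  apply: separable_Fadjoin_seq; apply/allP => u uus.
  have [->|u0] := eqVneq u 0; first by rewrite base_separable ?mem0v.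
  apply/separable_elementP; exists ('X^N - (u ^+ N)%:P); split.
  - by rewrite rpredB ?rpredX ?polyOverX ?polyOverC ?pus.
  - by rewrite /root !hornerE subrr.
  - by case: (Xn_sub_expE pz u0).
have fix1 g a : g \in 'Gal({:L} / 1)%g -> a \in 1%VS -> g a = a.
  by move=> gG a1; apply: (fixed_gal (subvf _) gG).
have act g u : g \in 'Gal({:L} / 1)%g -> u ^+ N \in 1%VS ->
    exists j, forall i, (g ^+ i)%g u = z ^+ j ^+ i * u.
  move=> gG uN; have /(prim_root_exp_eq pz)[j ej] : g u ^+ N = u ^+ N.
    by rewrite -rmorphXn /= fix1.
  exists j; elim=> [|i IHi]; first by rewrite expg0 gal_id mul1r.
  rewrite expgSr galM ?memvf // IHi rmorphM /= ej exprSr mulrA.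
  by rewrite (fix1 g) // !rpredX.
have galeq (g h : gal_of {:L}) : (forall u, u \in us -> g u = h u) -> g = h.
  move=> gh; apply/eqP/gal_eqP => a _.
  have: a \in <<in_tuple us>>%VS by rewrite sus memvf.
  move=> /coord_span ->; rewrite !linear_sum /=; apply: eq_bigr => i _.
  by rewrite !linearZ /= gh // mem_nth.
split=> //.
- apply/centsP => g gG h hG; apply: galeq => u /pus uN.
  have [i /(_ 1%N) ei] := act g u gG uN; have [j /(_ 1%N) ej] := act h u hG uN.
  rewrite !expg1 !expr1 in ei ej.
  rewrite !galM ?memvf // ei ej !rmorphM /= ei ej.
  by rewrite !fix1 ?rpredX // mulrCA.
- apply/exponentP => g gG; apply: galeq => u /pus uN.
  have [j ->] := act g u gG uN.
  by rewrite exprAC (prim_expr_order pz) expr1n mul1r gal_id.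
move=> y yN; have := galois_fixedField gal1 => /esym {2}->.
apply/fixedFieldP; rewrite ?memvf // => g gG.
have [j ej] := act g y gG yN; set e := exponent _ in ej *.
have := ej e; rewrite expg_exponent // gal_id => ee.
have := ej 1%N; rewrite expg1 expr1 => e1.
have [->|y0] := eqVneq y 0; first by rewrite rmorphXn /= rmorph0.
have /eqP : (z ^+ j ^+ e) * y = 1 * y by rewrite mul1r.
by rewrite (inj_eq (mulIf y0)) => /eqP zje; rewrite rmorphXn /= e1 exprMn zje mul1r.
Qed.

(** The last property says that the Kummer group for the exponent [N], a mere
    multiple of the exponent [e] of the Galois group, is the one for [e]. *)
Lemma kummer_abelian_exponent (Q : fieldType) (E : set Q) (n : nat)
    (u : 'I_n -> Q) (N : nat) (z : Q) : is_subfield E ->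
  lin_span E u = setT -> N.-primitive_root z -> E z ->
  (forall i, E (u i ^+ N)) ->
  exists e, [/\ abelian_exponent E e, (e %| N)%N
    & forall y, E (y ^+ N) -> E (y ^+ e)].
Proof.
move=> HE span_u pz Ez EuN.
have [p [b [_ basis_b]]] := lin_span_basis u HE.
have {basis_b} basis x := basis_b x (eq_ind_r (@^~ x) I span_u).
pose k := subfield_fieldType HE; pose iota := subfield_val HE.
pose L0 : fieldExtType k := based_fieldExt basis.
have mem1 (x : L0) : (x \in 1%VS) <-> E x.
  split=> [/vlineP[a ->]|Ex].
    by rewrite based_scaleE mulr1; apply: subfield_valP.
  have [a ax] := subfield_val_surj HE Ex.
  by apply/vlineP; exists a; rewrite based_scaleE mulr1.
pose us : seq L0 := [seq u i | i <- enum 'I_n].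
have sus : <<us>>%VS = {:L0}%VS.
  apply/eqP; rewrite eqEsubv subvf; apply/subvP => x _.
  have : lin_span E u x by rewrite span_u.
  move=> [c [Ec ->]]; apply: rpred_sum => i _.
  have [a <-] := subfield_val_surj HE (Ec i).
  rewrite -[_ * _]/(a *: (u i : L0)); apply: memvZ; apply: memv_span.
  by apply/mapP; exists i; rewrite ?mem_enum.
have pus v : v \in us -> v ^+ N \in 1%VS.
  by move=> /mapP[i _ ->]; apply/mem1/EuN.
have sp := @kummer_splitting k L0 N z us pz sus pus.
pose L : splittingFieldType k :=
  HB.pack (based_field basis)
    (FieldExt_isSplittingField.Build k (based_field basis) sp).
have [galL abL expL powL] := @kummer_galois k L N z us pz ((mem1 z).2 Ez) sus pus.
exists (exponent 'Gal({:L} / 1)%g); split=> //; last first.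
  by move=> y Ey; apply: (mem1 _).1; apply: powL; apply: (mem1 _).2.
pose f : {rmorphism L -> Q} := (idfun : {rmorphism Q -> Q}).
exists k, L, f; split=> //.
apply/seteqP; split=> [_ [y /mem1 Ey <-] //|y Ey].
by exists (y : L) => //; apply/mem1.
Qed.

Lemma sum_prim_root_pow (A : fieldType) (m : nat) (z : A) (i : nat) :
  m.-primitive_root z -> (i < m)%N ->
  \sum_(j < m) z ^+ (i * j) = if i == 0%N then m%:R else 0.
Proof.
move=> pz im; case: eqP => [->|/eqP i0].
  rewrite (eq_bigr (fun=> 1)) => [|j _]; last by rewrite mul0n expr0.
  by rewrite sumr_const card_ord.
have zi1 : z ^+ i - 1 != 0.
  rewrite subr_eq0 -(expr0 z) (eq_prim_root_expr pz) mod0n modn_small //.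
under eq_bigr do rewrite exprM.
apply: (mulfI zi1); rewrite mulr0 -subrX1 exprAC.
by rewrite (prim_expr_order pz) expr1n subrr.
Qed.

Section KummerEigenvectors.
Variables (k : fieldType) (L : splittingFieldType k) (m : nat) (z : L).
Hypotheses (pz : m.-primitive_root z) (z1 : z \in 1%VS).

(** As [c ^ m = 1], the power [v ^ m] is invariant under [g]; as [c] is in the
    base field, the eigenvalue survives applying other automorphisms to [v]. *)
Definition gal_eigenvector (g : gal_of {:L}) (v : L) : Prop :=
  exists c : L, [/\ c ^+ m = 1, c \in 1%VS & g v = c * v].

Let fix1 (g : gal_of {:L}) (a : L) :
  g \in 'Gal({:L} / 1)%g -> a \in 1%VS -> g a = a.
Proof. by move=> gG a1; apply: (fixed_gal (subvf _) gG). Qed.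

(** The components are the Lagrange resolvents
    [m^-1 sum_i z^(i j) g^i(v)], which inherit the eigenvalues of [v] for the
    automorphisms commuting with [g]. *)
Lemma gal_eigen_decomposition (g : gal_of {:L}) (v : L) :
  g \in 'Gal({:L} / 1)%g -> (g ^+ m = 1)%g ->
  exists w : nat -> L, [/\ v = \sum_(j < m) w j,
    forall j, gal_eigenvector g (w j)
  & forall h, h \in 'Gal({:L} / 1)%g -> commute g h ->
      gal_eigenvector h v -> forall j, gal_eigenvector h (w j)].
Proof.
move=> gG gm; have m0 := prim_order_gt0 pz.
have mR : m%:R != 0 :> L := prim_root_natf_neq0 pz.
have z0 : z != 0 by rewrite (prim_root_eq0 pz) -lt0n.
pose a j i := z ^+ (i * j) * (g ^+ i)%g v.
exists (fun j => m%:R^-1 * \sum_(i < m) a j i); split.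
- rewrite -mulr_sumr exchange_big /= (bigD1 (Ordinal m0)) //= [X in _ + X]big1 => [|i i0].
    rewrite addr0 /a -mulr_suml (sum_prim_root_pow pz m0) /= expg0 gal_id.
    by rewrite mulKf.
  rewrite /a -mulr_suml (sum_prim_root_pow pz (ltn_ord i)) ifN ?mul0r //.
- move=> j; exists (z^-1 ^+ j); split.
  + by rewrite exprAC exprVn (prim_expr_order pz) invr1 expr1n.
  + by rewrite rpredX // rpredV.
  rewrite rmorphM fmorphV rmorph_nat mulrCA; congr (_ * _).
  have ga i : g (a j i) = z^-1 ^+ j * a j i.+1.
    rewrite /a rmorphM /= (fix1 gG) ?rpredX // expgSr galM ?memvf // mulrA.
    by rewrite mulSn exprD mulrA exprVn mulVf ?expf_neq0 // mul1r.
  rewrite rmorph_sum /=; under eq_bigr do rewrite ga.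
  rewrite -mulr_sumr; congr (_ * _).
  case: m m0 gm pz @a {ga} => // m' _ gm pz' a.
  rewrite big_ord_recr big_ord_recl /= addrC; congr (_ + _).
  by rewrite /a gm expg0 !gal_id exprM (prim_expr_order pz') expr1n.
move=> h hG gh [c [cm c1 hv]] j; exists c; split=> //.
rewrite rmorphM fmorphV rmorph_nat mulrCA; congr (_ * _).
rewrite rmorph_sum /= mulr_sumr; apply: eq_bigr => i _.
rewrite /a rmorphM /= (fix1 hG) ?rpredX // mulrCA; congr (_ * _).
have gih : commute (g ^+ i) h by apply/commute_sym/commuteX/commute_sym.
by rewrite -galM ?memvf // gih galM ?memvf // hv rmorphM /= (fix1 _ c1) ?groupX.
Qed.

(** The resolvents are taken for one automorphism after the other. *)
Lemma simultaneous_gal_eigenvectors (s : seq (gal_of {:L})) (v : L) :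
  abelian 'Gal({:L} / 1) -> (exponent 'Gal({:L} / 1) %| m)%N ->
  {subset s <= 'Gal({:L} / 1)%g} ->
  exists us : seq L, v = \sum_(u <- us) u /\
    forall u g, u \in us -> g \in s -> gal_eigenvector g u.
Proof.
move=> /centsP abG expG; elim: s => [|g s IHs] sG.
  by exists [:: v]; split; [rewrite big_seq1|].
have [|us [-> eus]] := IHs; first by move=> h hs; apply: sG; rewrite inE hs orbT.
have gG : g \in 'Gal({:L} / 1)%g by apply: sG; rewrite inE eqxx.
have gm : (g ^+ m = 1)%g by move/exponentP: expG => ->.
elim: us eus => [|u us IHus] eus.
  by exists [::]; rewrite !big_nil; split=> // u h; rewrite in_nil.
have [|ws [ews Hws]] := IHus.
  by move=> u' h u'us; apply: eus; rewrite inE u'us orbT.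
have [w [ew gw hw]] := gal_eigen_decomposition u gG gm.
exists ([seq w j | j <- index_iota 0 m] ++ ws); split.
  rewrite big_cons big_cat ews big_map; congr (_ + _).
  by rewrite ew big_mkord.
move=> u' h; rewrite mem_cat => /orP[/mapP[j _ ->]|]; last exact: Hws.
rewrite inE => /orP[/eqP->|hs]; first exact: gw.
have hG : h \in 'Gal({:L} / 1)%g by apply: sG; rewrite inE hs orbT.
by apply: hw => //; [apply: abG|apply: eus; rewrite ?inE ?eqxx].
Qed.

(** An eigenvector of the whole Galois group has its [m]-th power fixed by the
    group, hence in the base field. *)
Lemma kummer_spanned : galois 1 {:L} ->
  abelian 'Gal({:L} / 1) -> (exponent 'Gal({:L} / 1) %| m)%N ->
  exists us : seq L, <<us>>%VS = {:L}%VS /\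
    forall u, u \in us -> u ^+ m \in 1%VS.
Proof.
move=> galL abG expG.
have dec v : exists us : seq L, v \in <<us>>%VS /\
    forall u, u \in us -> u ^+ m \in 1%VS.
  have [|us [-> eus]] :=
    @simultaneous_gal_eigenvectors (enum 'Gal({:L} / 1)%g) v abG expG.
    by move=> g; rewrite mem_enum.
  exists us; split.
    by rewrite big_seq; apply: rpred_sum => u uus; apply: memv_span.
  move=> u uus; move: galL => /galois_fixedField /esym ->.
  apply/fixedFieldP; rewrite ?memvf // => g gG.
  have [|c [cm _ gu]] := eus u g uus; first by rewrite mem_enum.
  by rewrite rmorphXn /= gu exprMn cm mul1r.
suff [us [sus Pus]] : exists us : seq L, {subset tval (vbasis {:L}) <= <<us>>%VS} /\
    forall u, u \in us -> u ^+ m \in 1%VS.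
  exists us; split=> //; apply/eqP; rewrite eqEsubv subvf.
  by rewrite -(span_basis (vbasisP {:L})); apply/span_subvP.
elim: (tval (vbasis {:L})) => [|v vs [us [sus Pus]]].
  by exists [::]; split=> v; rewrite in_nil.
have [us' [vus' Pus']] := dec v; exists (us' ++ us); split.
  rewrite span_cat => w; rewrite inE => /orP[/eqP->|/sus wus].
    exact: (subvP (addvSl _ _)).
  exact: (subvP (addvSr _ _)).
by move=> u; rewrite mem_cat => /orP[/Pus'|/Pus].
Qed.
End KummerEigenvectors.

Lemma prim_root_inj (A B : nzRingType) (f : {rmorphism A -> B}) (n : nat) (z : A) :
  injective f -> n.-primitive_root (f z) = n.-primitive_root z.
Proof.
move=> f_inj; congr (_ && _); apply: eq_forallb => i; congr (_ == _).
by rewrite !unity_rootE -rmorphXn -(rmorph1 f) (inj_eq f_inj).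
Qed.

Lemma kummer_field_ext_spanned (D : nzRingType) (E M : set D) (m : nat) :
  kummer_field_ext E M m ->
  [/\ is_subring M, forall x y, M x -> M y -> x * y = y * x,
      forall x, M x -> x != 0 -> exists2 y, M y & y * x = 1
    & exists n (c : 'I_n -> D), [/\ forall i, M (c i), forall i, E (c i ^+ m)
        & lin_span E c = M]].
Proof.
move=> [EM [L1 [j [jM abL]]] [zeta Ezeta prz]].
have jS x : M x -> exists y, j y = x by rewrite -jM => -[y _ <-]; exists y.
have jP y : M (j y) by rewrite -jM; exists y.
have Msub : is_subring M.
  split; first by rewrite -(rmorph1 j).
    by move=> _ _ /jS[x <-] /jS[y <-]; rewrite -rmorphB.
  by move=> _ _ /jS[x <-] /jS[y <-]; rewrite -rmorphM.
split=> //.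
- by move=> _ _ /jS[x <-] /jS[y <-]; rewrite -!rmorphM mulrC.
- move=> _ /jS[x <-]; rewrite fmorph_eq0 => x0.
  by exists (j x^-1) => //; rewrite -rmorphM mulVf // rmorph1.
have [k [L [f [bij_f fE galL abL' expL]]]] := abL.
have fEP y : y \in 1%VS -> E (j (f y)).
  by move=> y1; have : (f @` [set y | y \in 1%VS]) (f y) by [exists y]; rewrite fE.
have [y jy] := jS _ (EM _ Ezeta).
have : (j @^-1` E) y by rewrite /preimage /= jy.
rewrite -fE => -[z /= z1 fz].
have pz : m.-primitive_root z.
  rewrite -(prim_root_inj (f := f)); last exact: fmorph_inj.
  by rewrite fz -(prim_root_inj (f := j)) ?jy //; apply: fmorph_inj.
have [|us [sus pus]] := kummer_spanned pz z1 galL abL'; first by rewrite expL.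
exists (size us), (fun i => j (f us`_i)); split=> //.
- by move=> i; rewrite -!rmorphXn; apply: fEP; apply: pus; rewrite mem_nth.
apply/seteqP; split=> [_ [c [Ec ->]]|x Mx].
  have [M1 MB MM] := Msub; have M0 : M 0 by rewrite -(subrr 1); apply: MB.
  apply: (big_ind M) => // [a b Ma Mb|i _]; last by apply: MM => //; apply: EM.
  by rewrite -[b]opprK; apply: (MB) => //; rewrite -sub0r; apply: MB.
have [w jw] := jS _ Mx; have [g fg gf] := bij_f.
have : g w \in <<in_tuple us>>%VS by rewrite sus memvf.
move=> /coord_span e; exists (fun i => j (f (coord (in_tuple us) i (g w))%:A)).
split; first by move=> i; apply: fEP; rewrite memvZ ?mem1v.
rewrite -jw -(gf w) {1}e !rmorph_sum /=; apply: eq_bigr => i _.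
by rewrite -!rmorphM -scalerAl mul1r gf.
Qed.

(** * Fraction fields *)

Lemma frac_sub_subfield (D : nzRingType) (F : set D) (T : idomainType)
    (j : {rmorphism T -> D}) : is_subring F -> is_subfield (frac_sub F j).
Proof.
move=> [F1 FB FM]; have F0 : F 0 by rewrite -(subrr 1); apply: FB.
have FD a b : F a -> F b -> F (a + b).
  by move=> Fa Fb; rewrite -[b]opprK; apply: (FB) => //; rewrite -sub0r; apply: FB.
have nz (b : T) : b != 0 -> tofrac b != 0 by rewrite tofrac_eq0.
split; first split.
- by exists 1, 1; rewrite rmorph1 oner_eq0 divr1.
- move=> _ _ [a [b [Fa Fb b0 ->]]] [c [d [Fc Fd d0 ->]]].
  exists (a * d - c * b), (b * d).
  rewrite mulf_neq0 // !rmorphM rmorphB !rmorphM.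
  split=> //; first by apply: (FB); apply: FM.
  - exact: FM.
  by rewrite -mulNr addf_div ?nz // rmorphB !rmorphM mulNr.
- move=> _ _ [a [b [Fa Fb b0 ->]]] [c [d [Fc Fd d0 ->]]].
  exists (a * c), (b * d); rewrite mulf_neq0 // !rmorphM mulf_div.
  by split=> //; apply: FM.
move=> _ [a [b [Fa Fb b0 ->]]]; have [->|a0] := eqVneq a 0.
  by exists 0, 1; rewrite !rmorph0 !rmorph1 oner_eq0 !mul0r invr0.
by exists b, a; rewrite invf_div.
Qed.

(** Multiplication by [t] is an injective endomorphism of a finite-dimensional
    space containing [1], hence it is surjective. *)
Lemma lin_span_inv (Q : fieldType) (E : set Q) (n : nat) (u : 'I_n -> Q) (t : Q) :
  is_subfield E -> lin_span E u 1 ->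
  (forall x, lin_span E u x -> lin_span E u (t * x)) -> t != 0 ->
  lin_span E u t^-1.
Proof.
move=> HE V1 Vt t0; have [p [b [span_b basis]]] := lin_span_basis u HE.
set k := subfield_fieldType HE in basis; set iota := subfield_val HE in basis.
pose lc (c : 'rV[k]_p) := \sum_i iota (c 0 i) * b i.
have Vlc c : lin_span E u (lc c).
  rewrite -span_b; exists (fun i => iota (c 0 i)); split=> // i.
  exact: subfield_valP.
have lcB c d : lc (c - d) = lc c - lc d.
  by rewrite -sumrB; apply: eq_bigr => i _; rewrite !mxE rmorphB mulrBl.
have lc_inj c d : lc c = lc d -> c = d.
  move=> e; have [c' [_ uc']] := basis _ (Vlc c).
  by rewrite -(uc' c) // -(uc' d).
have Vb i : lin_span E u (b i).
  suff <- : lc (delta_mx 0 i) = b i by [].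
  rewrite /lc (bigD1 i) //= big1 => [|j ji].
    by rewrite mxE !eqxx mulr1n addr0; apply: mul1r.
  by rewrite mxE (negbTE ji) andbF mulr0n; apply: mul0r.
have /choice[a Ha] i : exists c, t * b i = lc c.
  by have [c [ec _]] := basis _ (Vt _ (Vb i)); exists c.
pose A := \matrix_i a i.
have tlc c : t * lc c = lc (c *m A).
  rewrite /lc mulr_sumr.
  under eq_bigr do rewrite mulrCA Ha /lc mulr_sumr.
  rewrite exchange_big; apply: eq_bigr => j _.
  rewrite mxE rmorph_sum mulr_suml; apply: eq_bigr => i _.
  by rewrite mxE rmorphM mulrA.
have uA : A \in unitmx.
  rewrite -row_free_unit -kermx_eq0; apply/rowV0P => v /sub_kermxP vA.
  apply: lc_inj; apply: (mulfI t0); rewrite !tlc vA; congr lc.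
  by rewrite mul0mx.
have [c [ec _]] := basis _ V1.
suff <- : lc (c *m invmx A) = t^-1 by [].
by apply: (mulfI t0); rewrite tlc mulmxKV // divff // {1}ec.
Qed.

Lemma fraction_quotient (T : idomainType) (x : {fraction T}) :
  exists a b : T, b != 0 /\ x = tofrac a / tofrac b.
Proof.
elim/quotW: x => y; have d0 := denom_ratioP y.
exists (frac y).1, (frac y).2; split=> //.
have D0 : tofrac (frac y).2 != 0 by rewrite tofrac_eq0.
apply: (mulIf D0); rewrite divfK //; unlock FracField.tofrac.
rewrite -[LHS]FracField.pi_mul; apply/eqmodP => /=.
by rewrite FracField.equivfE /FracField.mulf !numden_Ratio ?mulf_neq0 ?oner_neq0 //
  !mulr1 mulrC.
Qed.

(** Only inverses have to be dealt with: a span that is stable under the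
    multiplication by a nonzero [t] contains its inverse. *)
Lemma frac_spanned (D : nzRingType) (F : set D) (T : idomainType)
    (j : {rmorphism T -> D}) (n : nat) (u : 'I_n -> T) :
  is_subring F -> lin_span (j @^-1` F) u = setT ->
  lin_span (frac_sub F j) (fun i => tofrac (u i)) = setT.
Proof.
move=> Fsub span_u; have HE := frac_sub_subfield j Fsub.
set E := frac_sub F j in HE *; have [[E1 EB EM] EV] := HE.
have [F1 _ _] := Fsub.
have E0 : E 0 by rewrite -(subrr 1); apply: EB.
have ED a b : E a -> E b -> E (a + b).
  by move=> Ea Eb; rewrite -[b]opprK; apply: (EB) => //; rewrite -sub0r; apply: EB.
set V := lin_span E _.
have VT t : V (tofrac t).
  have : lin_span (j @^-1` F) u t by rewrite span_u.
  move=> [c [Fc ->]]; exists (fun i => tofrac (c i)); split.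
    move=> i; exists (c i), 1; rewrite rmorph1 oner_eq0 tofrac1 divr1.
    by split=> //; apply: Fc.
  by rewrite rmorph_sum /=; apply: eq_bigr => i _; rewrite rmorphM.
have VD x y : V x -> V y -> V (x + y).
  move=> [c [Ec ->]] [d [Ed ->]]; exists (fun i => c i + d i).
  split=> [i|]; first exact: ED.
  by rewrite -big_split; apply: eq_bigr => i _; rewrite mulrDl.
have VZ e x : E e -> V x -> V (e * x).
  move=> Ee [c [Ec ->]]; exists (fun i => e * c i).
  split=> [i|]; first exact: EM.
  by rewrite mulr_sumr; apply: eq_bigr => i _; rewrite mulrA.
have V0 : V 0 by rewrite -[0]tofrac0.
have Vmul t x : V x -> V (tofrac t * x).
  move=> [c [Ec ->]]; rewrite mulr_sumr; apply: (big_ind V) => // i _.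
  rewrite mulrCA -rmorphM; apply: VZ; [exact: Ec|exact: VT].
apply/seteqP; split=> // x _.
have [a [b [b0 ->]]] := fraction_quotient x; apply: (Vmul); apply: lin_span_inv => //.
- by have := VT 1; rewrite tofrac1.
- by move=> y; apply: Vmul.
- by rewrite tofrac_eq0.
Qed.

(** * The graded Kummer subfield spanned by commuting homogeneous units *)

Lemma setmul_coset (D : unitRingType) (E : set D) (x y : D) :
  units E 1 -> (forall u v, units E u -> units E v -> units E (u * v)) ->
  (forall u z, units E u -> z * u = u * z) ->
  setmul (coset_of_units E x) (coset_of_units E y) = coset_of_units E (x * y).
Proof.
move=> E1 EM EC; apply/seteqP; split=> [_ [_ [u Eu <-] [_ [v Ev <-] <-]]|_ [u Eu <-]].
  exists (u * v); first exact: EM.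
  by rewrite !mulrA; congr (_ * _); rewrite -!mulrA (EC u y).
exists x; first by exists 1; rewrite ?mulr1.
by exists (y * u); [exists u|rewrite mulrA].
Qed.

Section GradedKummerSubfield.
Variables (Gam : zmodType) (D : unitRingType) (gr : Gam -> set D) (F : set D).
Hypotheses (Gam_tf : torsion_free Gam) (Hg : is_grading gr)
  (gr_unit : forall g x, gr g x -> x != 0 -> x \is a GRing.unit)
  (F_gfield : graded_field gr F)
  (F_central : forall f x, F f -> f * x = x * f).
Variables (H : finGroupType) (cl : Gam -> H).
Hypothesis H_quot : is_quotient (gr_support gr [set: D]) (gr_support gr F) cl.
Variables (M : set D) (m : nat) (R : {group H}).
Hypotheses (M_deg0 : forall a, M a -> gr 0 a) (F0M : deg0 gr F `<=` M)
  (M_subring : is_subring M) (MC : forall a b, M a -> M b -> a * b = b * a)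
  (M_inv : forall a, M a -> a != 0 -> exists2 b, M b & b * a = 1).
Variables (n : nat) (c : 'I_n -> D).
Hypotheses (c_M : forall i, M (c i)) (c_pow : forall i, deg0 gr F (c i ^+ m))
  (c_span : lin_span (deg0 gr F) c = M).
Hypothesis F0_root : contains_prim_root (deg0 gr F) (m * exponent R).
Variable d : H -> H -> D.
Hypothesis d_cocycle : sym_cocycle *%R (KUM (deg0 gr F) M m) R d.
Variables (y : H -> D) (gam : H -> Gam) (h : H -> H -> D).
Hypotheses
  (y_homog : forall s, s \in R ->
     [/\ y s \is a GRing.unit, gr (gam s) (y s) & cl (gam s) = s])
  (yM : forall s a, s \in R -> M a -> y s * a = a * y s)
  (h_unit : forall s t, s \in R -> t \in R ->
     units F (h s t) /\ exists g, gr g (h s t))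
  (hC : forall s t, h s t = h t s)
  (y_mul : forall s t, s \in R -> t \in R ->
     y s * y t = d s t * h s t * y (s * t)%g).

Local Notation F0 := (deg0 gr F).

(** These turn out to be the homogeneous elements of [kummer_ring]. *)
Definition monomial (x : D) : Prop := exists a f s,
  [/\ M a, F f, exists g, gr g f, s \in R & x = a * f * y s].

Definition kummer_ring : set D :=
  [set x | exists l : seq D, (forall u, u \in l -> monomial u) /\
                             x = \sum_(u <- l) u].
Local Notation K := kummer_ring.

Let F_sub : is_subring F. Proof. by case: F_gfield => -[]. Qed.
Let F1 : F 1. Proof. by case: F_sub. Qed.
Let FB x1 x2 : F x1 -> F x2 -> F (x1 - x2).
Proof. by case: F_sub => _ FB _; apply: FB. Qed.
Let FM x1 x2 : F x1 -> F x2 -> F (x1 * x2).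
Proof. by case: F_sub => _ _; apply. Qed.
Let F_0 : F 0. Proof. by rewrite -(subrr 1); apply: FB. Qed.
Let FD x1 x2 : F x1 -> F x2 -> F (x1 + x2).
Proof.
move=> F1' F2; rewrite -[x2]opprK; apply: FB => //.
by rewrite -sub0r; apply: FB.
Qed.
Let FX x k : F x -> F (x ^+ k).
Proof. by move=> Fx; elim: k => [|k IHk] //; rewrite exprS; apply: FM. Qed.
Let M1 : M 1. Proof. by case: M_subring. Qed.
Let MM a b : M a -> M b -> M (a * b).
Proof. by case: M_subring => _ _; apply. Qed.
Let MB a b : M a -> M b -> M (a - b).
Proof. by case: M_subring => _ MB _; apply: MB. Qed.
Let M0 : M 0. Proof. by rewrite -(subrr 1); apply: MB. Qed.
Let MD a b : M a -> M b -> M (a + b).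
Proof.
move=> Ma Mb; rewrite -[b]opprK; apply: MB => //.
by rewrite -sub0r; apply: MB.
Qed.

Let F_inv f g : F f -> gr g f -> f != 0 -> F f^-1.
Proof. by case: F_gfield => _ _ U Ff gf f0; case: (U g f Ff gf f0). Qed.

Let M_invr a : M a -> a != 0 -> M a^-1.
Proof.
move=> Ma a0; have [b Mb ba] := M_inv Ma a0.
suff -> : a^-1 = b by [].
by rewrite -[b]mulr1 -(mulrV (gr_unit (M_deg0 Ma) a0)) mulrA ba mul1r.
Qed.

Let component_F g x : F x -> F (component Hg g x).
Proof.
case: F_gfield => -[_ Fspan] _ _ /Fspan[s [e [Fe ->]]].
rewrite raddf_sum /=; apply: (big_ind F) => // i _.
have [Fi gi] := Fe i; rewrite (component_id Hg _ gi).
by case: eqP.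
Qed.

Let dP s t : s \in R -> t \in R ->
  [/\ M (d s t), d s t \is a GRing.unit & F0 (d s t ^+ m)].
Proof.
by move=> sR tR; case: d_cocycle => Hd _ _; have [[]] := Hd s t sR tR.
Qed.

Let HC (s t : H) : (s * t)%g = (t * s)%g.
Proof.
have [clM clS _] := H_quot.
have [g Gg <-] := clS s; have [k Gk <-] := clS t.
by rewrite -!clM // addrC.
Qed.

Let yC s t : s \in R -> t \in R -> y s * y t = y t * y s.
Proof.
move=> sR tR; rewrite !y_mul // hC HC.
by case: d_cocycle => _ _ ->.
Qed.

Let in_supp g x : gr g x -> x != 0 -> gr_support gr [set: D] g.
Proof. by move=> gx x0; exists x. Qed.

Let unit_neq0 (x : D) : x \is a GRing.unit -> x != 0.
Proof. by apply: contraTneq => ->; rewrite unitr0. Qed.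

Let mulf_neq0D (x1 x2 : D) : x1 * x2 != 0 -> x1 != 0 /\ x2 != 0.
Proof.
by move=> x12; split; apply: contraNneq x12 => ->; rewrite ?mul0r ?mulr0.
Qed.

Let monomial_mulE a f s b g t : M b -> F f -> F g -> s \in R ->
  (a * f * y s) * (b * g * y t) = (a * b) * (f * g) * (y s * y t).
Proof.
move=> Mb Ff Fg sR; rewrite !mulrA; congr (_ * _).
rewrite -(mulrA (a * f) (y s) b) yM // !mulrA.
rewrite -(mulrA _ (y s) g) -(F_central _ Fg) !mulrA; congr (_ * _ * _).
by rewrite -!mulrA (F_central _ Ff).
Qed.

Lemma monomial_mul x1 x2 : monomial x1 -> monomial x2 -> monomial (x1 * x2).
Proof.
move=> [a [f [s [Ma Ff [g gf] sR ->]]]] [b [f' [t [Mb Ff' [g' gf'] tR ->]]]].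
have [Md _ _] := dP sR tR; have [[Fh _ _] [k kh]] := h_unit sR tR.
exists (a * b * d s t), (f * f' * h s t), (s * t)%g; split; rewrite ?groupM //.
- by do 2?apply: MM.
- by do 2?apply: FM.
- by exists (g + g' + k); do 2?apply: (gr_mul Hg).
rewrite monomial_mulE // y_mul // !mulrA; congr (_ * _ * _).
by rewrite -!mulrA; congr (_ * (_ * _)); rewrite mulrA (F_central _ (FM Ff Ff')).
Qed.

Lemma monomialC x1 x2 : monomial x1 -> monomial x2 -> x1 * x2 = x2 * x1.
Proof.
move=> [a [f [s [Ma Ff _ sR ->]]]] [b [f' [t [Mb Ff' _ tR ->]]]].
by rewrite !monomial_mulE // yC // (MC Ma) // (F_central _ Ff).
Qed.

(** As [y_1] need not be [1], this is what makes the elements of [M] and the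
    homogeneous elements of [F] monomials. *)
Let y1E : y 1%g = d 1%g 1%g * h 1%g 1%g.
Proof.
have [uy _ _] := y_homog (group1 R).
have := y_mul (group1 R) (group1 R); rewrite mulg1 => e.
by apply: (mulIr uy).
Qed.

Lemma monomial_M a : M a -> monomial a.
Proof.
move=> Ma; have [Md ud _] := dP (group1 R) (group1 R).
have [[Fh uh Fhi] [k kh]] := h_unit (group1 R) (group1 R).
exists (a * (d 1%g 1%g)^-1), (h 1%g 1%g)^-1, 1%g; split=> //.
- by apply: MM => //; apply: M_invr => //; apply: unit_neq0.
- by exists (- k); apply: homog_inv.
by rewrite y1E -!mulrA (F_central _ Fhi) -!mulrA mulrV // mulr1 mulVr ?mulr1.
Qed.

Lemma monomial_F f g : F f -> gr g f -> monomial f.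
Proof.
move=> Ff gf; have [Md ud _] := dP (group1 R) (group1 R).
have [[Fh uh Fhi] [k kh]] := h_unit (group1 R) (group1 R).
exists (d 1%g 1%g)^-1, (f * (h 1%g 1%g)^-1), 1%g; split=> //.
- by apply: M_invr => //; apply: unit_neq0.
- exact: FM.
- by exists (g - k); apply: (gr_mul Hg) => //; apply: homog_inv.
rewrite y1E mulrA -(F_central _ (FM Ff Fhi)) -(mulrA (f * _)) mulVr // mulr1.
by rewrite -mulrA mulVr // mulr1.
Qed.

Lemma monomial_y s : s \in R -> monomial (y s).
Proof.
move=> sR; exists 1, 1, s; rewrite !mul1r; split=> //.
by exists 0; apply: (gr_one Hg).
Qed.

Lemma monomial_homog x : monomial x -> exists g, gr g x.
Proof.
move=> [a [f [s [Ma _ [g gf] sR ->]]]]; have [_ gy _] := y_homog sR.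
by exists (0 + g + gam s); do 2?apply: (gr_mul Hg) => //; apply: M_deg0.
Qed.

(* y_s^-1 is obtained from y_(s^-1), since y_s y_(s^-1) is a unit of M F *)
Lemma monomial_inv x : monomial x -> x != 0 -> monomial x^-1.
Proof.
move=> mx x0; have [gx Gx] := monomial_homog mx.
case: mx => a [f [s [Ma Ff [g gf] sR e]]].
have := x0; rewrite e => /mulf_neq0D[/mulf_neq0D[a0 f0] _].
have ux := gr_unit Gx x0; have sV : (s^-1)%g \in R by rewrite groupV.
have my : monomial (y s)^-1.
  have [Md ud _] := dP sR sV; have [[Fh uh Fhi] [k kh]] := h_unit sR sV.
  have [uy _ _] := y_homog sR.
  have -> : (y s)^-1 = y (s^-1)%g * (d s s^-1%g * h s s^-1%g * y 1%g)^-1.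
    rewrite -(mulgV s) -y_mul // invrM //; last by case: (y_homog sV).
    by rewrite mulVKr //; case: (y_homog sV).
  apply: monomial_mul; first exact: monomial_y.
  have [u1 _ _] := y_homog (group1 R).
  have [Md1 ud1 _] := dP (group1 R) (group1 R).
  have [[Fh1 uh1 Fhi1] [k1 kh1]] := h_unit (group1 R) (group1 R).
  have udh : d s s^-1%g * h s s^-1%g \is a GRing.unit by rewrite unitrMr.
  rewrite (invrM udh u1) (invrM ud uh) y1E (invrM ud1 uh1).
  apply: monomial_mul; apply: monomial_mul.
  - by apply: (monomial_F Fhi1 (homog_inv Hg kh1 uh1)).
  - by apply: monomial_M; apply: M_invr => //; apply: unit_neq0.
  - by apply: (monomial_F Fhi (homog_inv Hg kh uh)).
  - by apply: monomial_M; apply: M_invr => //; apply: unit_neq0.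
have ua := gr_unit (M_deg0 Ma) a0; have uf := gr_unit gf f0.
have [uy _ _] := y_homog sR.
have uaf : a * f \is a GRing.unit by rewrite unitrMr.
rewrite (invrM uaf uy) (invrM ua uf).
apply: monomial_mul => //; apply: monomial_mul.
  by apply: (monomial_F (F_inv Ff gf f0) (homog_inv Hg gf uf)).
by apply: monomial_M; apply: M_invr.
Qed.

(** Elements of [M] have degree [0], and degrees of elements of [F] have trivial
    class, so [s] is determined by the degree. *)
Lemma monomial_cl g x : monomial x -> gr g x -> x != 0 ->
  exists a f s k, [/\ M a, F f, gr k f, s \in R & x = a * f * y s] /\
    [/\ cl g = s, a != 0, f != 0 & g = k + gam s].
Proof.
move=> [a [f [s [Ma Ff [k gf] sR e]]]] gx x0.
have := x0; rewrite e => /mulf_neq0D[/mulf_neq0D[a0 f0] _].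
have [uy gy cy] := y_homog sR.
have eg : g = k + gam s.
  apply: (homog_degree_unique Hg gx _ x0); rewrite e -[k]add0r.
  by do 2?apply: (gr_mul Hg) => //; apply: M_deg0.
exists a, f, s, k; split=> //; split=> //.
have [clM _ cl1] := H_quot.
have suppk : gr_support gr [set: D] k by apply: in_supp gf f0.
rewrite eg clM //; last by apply: in_supp gy _; apply: unit_neq0.
have -> : cl k = 1%g by apply/(cl1 k suppk); exists f.
by rewrite mul1g.
Qed.

(** Two monomials of the same degree involve the same [y_s], and their factors
    in [F] differ by an element of [F_0], which [M] contains. *)
Lemma monomial_add g x1 x2 : monomial x1 -> monomial x2 -> gr g x1 -> gr g x2 ->
  monomial (x1 + x2).
Proof.
move=> m1 m2 g1 g2.
have [->|x1n] := eqVneq x1 0; first by rewrite add0r.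
have [->|x2n] := eqVneq x2 0; first by rewrite addr0.
have [a [f [s [k [[Ma Ff kf sR ->] [gs a0 f0 gk]]]]]] := monomial_cl m1 g1 x1n.
have [b [f' [t [k' [[Mb Ff' kf' _ ->] [gt b0 f0' gk']]]]]] :=
  monomial_cl m2 g2 x2n.
have est : t = s by rewrite -gt gs.
rewrite {}est in gk' *; have ek := addIr _ (etrans (esym gk') gk).
rewrite {}ek in kf'.
have uf := gr_unit kf f0.
exists (a + b * (f' * f^-1)), f, s; split=> //.
- apply: MD => //; apply: MM => //; apply: F0M; split.
    by apply: FM => //; apply: F_inv kf f0.
  by rewrite -(subrr k); apply: (gr_mul Hg) => //; apply: homog_inv.
- by exists k.
rewrite !mulrDl; congr (_ + _ * _).
by rewrite -!mulrA mulVr // mulr1.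
Qed.

Lemma monomial_0 : monomial 0.
Proof.
exists 0, 1, 1%g; rewrite !mul0r; split=> //.
by exists 0; apply: (gr_one Hg).
Qed.

Lemma monomial_opp x : monomial x -> monomial (- x).
Proof.
move=> [a [f [s [Ma Ff gf sR ->]]]]; exists (- a), f, s; split=> //.
  by rewrite -sub0r; apply: MB.
by rewrite !mulNr.
Qed.

Lemma kummer_ring_monomial x : monomial x -> K x.
Proof.
by move=> mx; exists [:: x]; rewrite big_seq1; split=> // u; rewrite inE => /eqP->.
Qed.

Let KD x1 x2 : K x1 -> K x2 -> K (x1 + x2).
Proof.
move=> [l1 [m1 ->]] [l2 [m2 ->]]; exists (l1 ++ l2); rewrite big_cat.
by split=> // u; rewrite mem_cat => /orP[/m1|/m2].
Qed.

Let K0 : K 0. Proof. exact: kummer_ring_monomial monomial_0. Qed.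

Lemma kummer_ring_ind (P : D -> Prop) : P 0 ->
  (forall x1 x2, P x1 -> P x2 -> P (x1 + x2)) ->
  (forall x, monomial x -> P x) -> forall x, K x -> P x.
Proof.
move=> P0 PD Pm x [l [ml ->]]; rewrite big_seq.
by apply: (big_ind P) => // u /ml /Pm.
Qed.

Let KN x : K x -> K (- x).
Proof.
move=> Kx; apply: (kummer_ring_ind (P := fun x => K (- x))) Kx.
- by rewrite oppr0.
- by move=> x1 x2 K1 K2; rewrite opprD; apply: KD.
- by move=> u /monomial_opp /kummer_ring_monomial.
Qed.

Let KM x1 x2 : K x1 -> K x2 -> K (x1 * x2).
Proof.
move=> Kx1 Kx2; apply: (kummer_ring_ind (P := fun x => K (x * x2))) Kx1.
- by rewrite mul0r.
- by move=> u v Ku Kv; rewrite mulrDl; apply: KD.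
move=> u mu; apply: (kummer_ring_ind (P := fun x => K (u * x))) Kx2.
- by rewrite mulr0.
- by move=> v w Kv Kw; rewrite mulrDr; apply: KD.
by move=> v mv; apply: kummer_ring_monomial; apply: monomial_mul.
Qed.

Let KC x1 x2 : K x1 -> K x2 -> x1 * x2 = x2 * x1.
Proof.
move=> Kx1 Kx2; apply: (kummer_ring_ind (P := fun x => x * x2 = x2 * x)) Kx1.
- by rewrite mul0r mulr0.
- by move=> u v Ku Kv; rewrite mulrDl mulrDr Ku Kv.
move=> u mu; apply: (kummer_ring_ind (P := fun x => u * x = x * u)) Kx2.
- by rewrite mul0r mulr0.
- by move=> v w Kv Kw; rewrite mulrDl mulrDr Kv Kw.
by move=> v mv; apply: monomialC.
Qed.

Lemma kummer_ring_component g x : K x -> monomial (component Hg g x).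
Proof.
move=> Kx; suff [] : monomial (component Hg g x) /\ gr g (component Hg g x) by [].
apply: (kummer_ring_ind (P := fun x => monomial (component Hg g x) /\
  gr g (component Hg g x))) Kx.
- by rewrite raddf0; split; [exact: monomial_0|exact: (gr_zero Hg)].
- move=> x1 x2 [m1 g1] [m2 g2]; rewrite raddfD; split; last exact: homog_add.
  exact: monomial_add m1 m2 g1 g2.
move=> u mu; split; last exact: component_homog.
have [k gk] := monomial_homog mu; rewrite (component_id Hg _ gk).
by case: eqP => // _; apply: monomial_0.
Qed.

Lemma kummer_ring_homog g x : K x -> gr g x -> monomial x.
Proof.
by move=> /(kummer_ring_component g) + gx; rewrite (component_id Hg _ gx) eqxx.
Qed.

Let F_sub_K : F `<=` K.
Proof.
move=> f Ff; have [s [_ _ ->]] := component_sum Hg f.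
apply: (big_ind K) => // g _; apply: kummer_ring_monomial.
by apply: (monomial_F (component_F g Ff)); apply: component_homog.
Qed.

Lemma kummer_ring_subring : is_subring K.
Proof.
split=> //; first exact: F_sub_K.
by move=> x1 x2 K1 K2; apply: KD => //; apply: KN.
Qed.

Lemma kummer_ring_graded_subfield : graded_subfield gr F K.
Proof.
split=> //; split=> //.
- split; first exact: kummer_ring_subring.
  move=> x Kx; have [s [_ _ xs]] := component_sum Hg x.
  exists s, (component Hg ^~ x); split=> // g; split; last exact: component_homog.
  exact: kummer_ring_monomial (kummer_ring_component g Kx).
move=> g x Kx gx x0; split=> //; first exact: gr_unit gx x0.
apply: kummer_ring_monomial; apply: monomial_inv => //.
exact: kummer_ring_homog Kx gx.
Qed.

(** A monomial [a f y_s] of degree [0] has [s = 1]; as [y_1] is in [M F],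
    it is then the product of an element of [M] and one of [F_0]. *)
Lemma kummer_ring_deg0 : deg0 gr K = M.
Proof.
apply/seteqP; split=> [x [Kx g0]|a Ma]; last first.
  by split; [exact: kummer_ring_monomial (monomial_M Ma)|exact: M_deg0].
have [->|x0] := eqVneq x 0; first exact: M0.
have mx := kummer_ring_homog Kx g0.
have [a [f [s [k [[Ma Ff kf sR ->] [cs a0 f0 ek]]]]]] := monomial_cl mx g0 x0.
have [clM clS cl1] := H_quot.
have supp0 : gr_support gr [set: D] 0 by apply: in_supp g0 x0.
have s1 : s = 1%g.
  rewrite -cs; apply/(cl1 0 supp0).
  by exists 1; [split=> //; exact: (gr_one Hg)|exact: oner_neq0].
rewrite {s sR cs}s1 in ek *; rewrite y1E.
have [Md ud _] := dP (group1 R) (group1 R).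
have [[Fh uh Fhi] [l lh]] := h_unit (group1 R) (group1 R).
have gl : gr (gam 1%g) (d 1%g 1%g * h 1%g 1%g).
  by rewrite -y1E; case: (y_homog (group1 R)).
have el : gam 1%g = l.
  have dl : gr l (d 1%g 1%g * h 1%g 1%g).
    by rewrite -[l]add0r; apply: (gr_mul Hg) => //; apply: M_deg0.
  by apply: (homog_degree_unique Hg gl dl); apply: unit_neq0; rewrite unitrMr.
have -> : a * f * (d 1%g 1%g * h 1%g 1%g) =
    (a * d 1%g 1%g) * (f * h 1%g 1%g).
  by rewrite !mulrA; congr (_ * _); rewrite -!mulrA (F_central _ Ff).
apply: MM; first exact: MM.
by apply: F0M; split; [exact: FM|rewrite ek el; exact: (gr_mul Hg)].
Qed.

Lemma kummer_ring_support : cl @` gr_support gr K = [set s | s \in R].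
Proof.
apply/seteqP; split=> [_ [g [x [Kx gx] x0] <-]|s sR].
  have [a [f [s [k [[_ _ _ sR _] [-> _ _ _]]]]]] :=
    monomial_cl (kummer_ring_homog Kx gx) gx x0.
  exact: sR.
have [uy gy cy] := y_homog sR; exists (gam s) => //.
exists (y s); last exact: unit_neq0.
by split=> //; apply: kummer_ring_monomial; apply: monomial_y.
Qed.

Definition kummer_generator (p : 'I_n * H) : D :=
  if p.2 \in R then c p.1 * y p.2 else 0.

Let gen (i : 'I_#|{: 'I_n * H}|) : D := kummer_generator (enum_val i).

Let span_gen (e : 'I_n * H -> D) : (forall p, F (e p)) ->
  lin_span F gen (\sum_p e p * kummer_generator p).
Proof.
move=> Fe; exists (fun i => e (enum_val i)); split=> //.
exact: (big_enum_val (fun p => e p * kummer_generator p)).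
Qed.

Let span_genD x1 x2 : lin_span F gen x1 -> lin_span F gen x2 ->
  lin_span F gen (x1 + x2).
Proof.
move=> [e1 [F1' ->]] [e2 [F2' ->]]; exists (fun i => e1 i + e2 i).
split=> [i|]; first exact: FD.
by rewrite -big_split; apply: eq_bigr => i _; rewrite mulrDl.
Qed.

Let gen_K i : K (gen i).
Proof.
rewrite /gen /kummer_generator; case: ifP => // sR.
by apply: KM; apply: kummer_ring_monomial; [exact: monomial_M|exact: monomial_y].
Qed.

Lemma kummer_ring_span : lin_span F gen = K.
Proof.
apply/seteqP; split=> [_ [e [Fe ->]]|x].
  by apply: (big_ind K) => // i _; apply: KM => //; apply: F_sub_K.
apply: kummer_ring_ind => //.
  exists (fun=> 0); split=> //.
  by rewrite big1 // => i _; rewrite mul0r.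
move=> _ [a [f [s [Ma Ff _ sR ->]]]].
move: Ma; rewrite -{1}c_span => -[e [Fe ->]].
have -> : (\sum_(i < n) e i * c i) * f * y s =
    \sum_p (if p.2 == s then e p.1 * f else 0) * kummer_generator p.
  rewrite -(pair_bigA _ (fun i t =>
    (if t == s then e i * f else 0) * kummer_generator (i, t))) /=.
  rewrite !mulr_suml; apply: eq_bigr => i _.
  rewrite (bigD1 s) //= eqxx big1 => [|t /negbTE ->]; last by rewrite mul0r.
  rewrite addr0 /kummer_generator sR /= !mulrA; congr (_ * _).
  by rewrite -!mulrA (F_central _ Ff).
apply: span_gen => p; case: ifP => // _; apply: FM => //.
by case: (Fe p.1).
Qed.

(** A relation between homogeneous generators splits into homogeneous ones,
    whose nonzero coefficients are units of [F], so a free subfamily exists. *)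
Lemma kummer_ring_finite_dim : finite_dim F K.
Proof.
have Fsub := F_sub.
pose G := [set x | K x /\ exists g, gr g x].
have [q b e Gb Fe [i0 ei0] eb|i|p [b [Gb sb fb]]] :=
    @free_subfamily D F G Fsub _ _ gen.
- have [g eg0] := component_neq0 Hg ei0.
  have /choice[k gk] i : exists k, gr k (b i) by case: (Gb i).
  (* homogeneous part, in degree g + k i0, of the relation *)
  pose e' i := component Hg (g + k i0 - k i) (e i).
  have e'i0 : e' i0 = component Hg g (e i0) by rewrite /e' addrK.
  have Fe' i : F (e' i) by apply: component_F.
  have ue : e' i0 \is a GRing.unit.
    by rewrite e'i0; apply: gr_unit eg0; apply: component_homog.
  have Fei : F (e' i0)^-1.
    apply: F_inv (Fe' i0) (component_homog Hg _ _) _.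
    exact: unit_neq0.
  exists (fun i => (e' i0)^-1 * e' i), i0; split=> [i||]; [exact: FM|exact: mulVr|].
  under eq_bigr do rewrite -mulrA.
  suff e'b : \sum_(i < q) e' i * b i = 0 by rewrite -mulr_sumr e'b mulr0.
  rewrite -[RHS](raddf0 (component Hg (g + k i0))) -[in RHS]eb raddf_sum /=.
  apply: eq_bigr => i _.
  by rewrite -[in RHS](subrK (k i) (g + k i0)) (component_mulr Hg _ _ (gk i)).
- split; first exact: gen_K.
  rewrite /gen /kummer_generator; case: ifP => [sR|_]; last first.
    by exists 0; apply: (gr_zero Hg).
  have [_ gy _] := y_homog sR.
  by eexists; apply: (gr_mul Hg) gy; apply/M_deg0/c_M.
rewrite kummer_ring_span in sb.
exists p, b; split=> [i|x Kx]; first by case: (Gb i).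
move: Kx; rewrite -sb => -[e [Fe ->]].
exists [ffun i => e i]; split.
  by split=> [i|]; [rewrite ffunE|apply: eq_bigr => i _; rewrite ffunE].
move=> e' [Fe' ee']; apply/ffunP => i; rewrite ffunE; apply/eqP.
rewrite -subr_eq0; apply/eqP; apply: (fb (fun i => e i - e' i)).
  by move=> j; apply: FB.
by under eq_bigr do rewrite mulrBl; rewrite sumrB ee' subrr.
Qed.

(** Modulo [M] and [F], powers of [y_s] are given by the group law of [R]. *)
Let y_pow s k : s \in R -> exists a f,
  [/\ M a, F0 (a ^+ m), units F f & y s ^+ k.+1 = a * f * y (s ^+ k.+1)%g].
Proof.
move=> sR; elim: k => [|k [a [f [Ma am [Ff uf Ffi] e]]]].
  exists 1, 1; rewrite expr1n !mul1r; split=> //.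
    by split=> //; apply: (gr_one Hg).
  by split; rewrite ?invr1 ?unitr1.
have st : (s ^+ k.+2 = s * s ^+ k.+1)%g := expgS s k.+1.
have skR : (s ^+ k.+1)%g \in R by rewrite groupX.
rewrite {}st; move: (s ^+ k.+1)%g skR e => t skR e.
have [Md ud [Fdm gdm]] := dP sR skR; have [[Fh uh Fhi] _] := h_unit sR skR.
exists (a * d s t), (f * h s t); split.
- exact: MM.
- rewrite exprMn_comm; last exact: MC.
  by case: am => Fa ga; split; [exact: FM|rewrite -[0]addr0; exact: (gr_mul Hg)].
- split; [exact: FM|by rewrite unitrMr|rewrite invrM //; exact: FM].
rewrite exprS e !mulrA yM // -(mulrA a) -(F_central _ Ff) mulrA -(mulrA (a * f)).
rewrite y_mul // !mulrA; congr (_ * _ * _).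
by rewrite -(mulrA a f) (F_central _ Ff) mulrA.
Qed.

Let y_powN s : s \in R -> F (y s ^+ (m * exponent R)).
Proof.
move=> sR; have [e0 se] : (0 < exponent R)%N /\ (s ^+ exponent R = 1)%g.
  by split; [exact: exponent_gt0|exact: expg_exponent].
case: (exponent R) e0 se => // k _ sk.
have [a [f [Ma [Fam _] [Ff uf Ffi] e]]] := y_pow k sR.
have [Md ud [Fdm gdm]] := dP (group1 R) (group1 R).
have [[Fh uh Fhi] _] := h_unit (group1 R) (group1 R).
rewrite mulnC exprM e sk y1E.
have -> : a * f * (d 1%g 1%g * h 1%g 1%g) =
    (a * d 1%g 1%g) * (f * h 1%g 1%g).
  by rewrite !mulrA; congr (_ * _); rewrite -!mulrA (F_central _ Ff).
rewrite exprMn_comm; last by apply/esym/F_central/FM.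
rewrite [in X in X * _]exprMn_comm; last exact: MC.
by apply: FM; [exact: FM|apply: FX; exact: FM].
Qed.

Let gen_pow i : F (gen i ^+ (m * exponent R)).
Proof.
rewrite /gen /kummer_generator; case: ifP => [sR|_].
  rewrite exprMn_comm; last by apply/esym/yM.
  by apply: FM; [rewrite exprM; apply: FX; case: (c_pow (enum_val i).1)|exact: y_powN].
by rewrite expr0n; case: eqP.
Qed.

Let K_domain : is_comm_subdomain K.
Proof.
split=> //; first exact: kummer_ring_subring.
by move=> x1 x2 _ _; apply: (graded_division_domain Hg gr_unit Gam_tf).
Qed.

(** If [t = a / b] is homogeneous, comparing the components of [t b = a] in one
    degree expresses [t] as a quotient of homogeneous elements of [F]. *)
Lemma frac_sub_F (T : idomainType) (j : {rmorphism T -> D}) (t : T) :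
  injective j -> K (j t) -> (exists2 g, gr g (j t) & j t != 0) ->
  frac_sub F j (tofrac t) -> F (j t).
Proof.
move=> j_inj Kt [g gt t0] [a [b [Fa Fb b0 /eqP]]].
have b0' : tofrac b != 0 by rewrite tofrac_eq0.
rewrite -(can2_eq (mulfK b0') (divfK b0')) -rmorphM tofrac_eq => /eqP e.
have jb0 : j b != 0 by rewrite -(rmorph0 j) (inj_eq j_inj).
have [k bk0] := component_neq0 Hg jb0.
have uk := gr_unit (component_homog Hg k (j b)) bk0.
have Fk := component_F k Fb.
have := component_mull Hg k (j b) gt; rewrite -rmorphM e.
move=> /(congr1 (fun z => z / component Hg k (j b))).
rewrite mulrK // => <-; apply: FM; first exact: component_F.
exact: F_inv Fk (component_homog Hg k (j b)) bk0.
Qed.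

(** The last property shows that [y s] represents an element of [kum(K / F)],
    which is defined with the exact exponent [e] of the Galois group. *)
Lemma kummer_ring_kummer : exists e, kummer_graded_subfield gr F K e /\
  forall s, s \in R -> F (y s ^+ e).
Proof.
pose T := subdomain_idomainType K_domain.
pose j : {rmorphism T -> D} := subdomain_val K_domain.
have j_inj : injective j := @subdomain_val_inj _ _ K_domain.
have jK : range j = K := range_subdomain_val K_domain.
have jS x : K x -> exists t, j t = x by rewrite -jK => -[t _ <-]; exists t.
have jP t : K (j t) by rewrite -jK; exists t.
have /choice[u ju] i : exists t, j t = gen i by apply: jS.
have span_u : lin_span (j @^-1` F) u = setT.
  apply/seteqP; split=> // t _; have : K (j t) by [].
  rewrite -{1}kummer_ring_span => -[e [Fe et]].
  have /choice[w jw] i : exists t, j t = e i by apply/jS/F_sub_K.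
  exists w; split=> [i|]; first by have := Fe i; rewrite -jw.
  apply: j_inj; rewrite et rmorph_sum; apply: eq_bigr => i _.
  by rewrite rmorphM jw ju.
have [zeta [Fz gz] prz] := F0_root.
have [z jz] := jS _ (F_sub_K Fz).
have pz : (m * exponent R).-primitive_root (tofrac z).
  rewrite (prim_root_inj (f := @FracField.tofrac T)) -?(prim_root_inj (f := j)) ?jz //.
  by move=> t1 t2 /eqP; rewrite tofrac_eq => /eqP.
have fracF t : F (j t) -> frac_sub F j (tofrac t).
  by move=> Ft; exists t, 1; rewrite rmorph1 tofrac1 divr1 oner_eq0.
have [||e [abe eN powe]] := kummer_abelian_exponent (frac_sub_subfield j F_sub)
    (frac_spanned F_sub span_u) pz.
- by apply: fracF; rewrite jz.
- by move=> i; rewrite -rmorphXn; apply: fracF; rewrite rmorphXn ju; apply: gen_pow.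
exists e; split.
  split.
  - exact: kummer_ring_graded_subfield.
  - exact: kummer_ring_finite_dim.
  - by exists T, j.
  exists (zeta ^+ (m * exponent R %/ e)); last exact: dvdn_prim_root.
  by split; [exact: FX|rewrite -[0](mul0rn _ (m * exponent R %/ e)); exact: homog_exp].
move=> s sR; have [t jt] := jS _ (kummer_ring_monomial (monomial_y sR)).
have [uy gy _] := y_homog sR.
rewrite -jt -rmorphXn; apply: frac_sub_F => //.
  exists (gam s *+ e); rewrite rmorphXn jt; first exact: homog_exp.
  by apply: unit_neq0; rewrite unitrX.
rewrite rmorphXn; apply: powe; rewrite -rmorphXn; apply: fracF.
by rewrite rmorphXn jt; apply: y_powN.
Qed.

Let F_units_central f x : units F f -> x * f = f * x.
Proof. by case=> Ff _ _; rewrite (F_central _ Ff). Qed.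

Let units_F0_F : units F0 `<=` units F.
Proof. by move=> u [[Fu _] uu [Fui _]]. Qed.

Let units_F0_central f x : units F0 f -> x * f = f * x.
Proof. by move=> /units_F0_F/F_units_central. Qed.

Let units_mul_F f g : units F f -> units F g -> units F (f * g).
Proof.
move=> [Ff uf Ffi] [Fg ug Fgi]; split; [exact: FM|by rewrite unitrMr|].
by rewrite invrM //; apply: FM.
Qed.

Let F0_1 : F0 1. Proof. by split => //; apply: (gr_one Hg). Qed.

Let F0M_closed f g : F0 f -> F0 g -> F0 (f * g).
Proof.
move=> [Ff gf] [Fg gg]; split; first exact: FM.
by rewrite -[0]addr0; apply: (gr_mul Hg).
Qed.

Let units_mul_F0 f g : units F0 f -> units F0 g -> units F0 (f * g).
Proof.
move=> [Ff uf Ffi] [Fg ug Fgi]; split; [exact: F0M_closed|by rewrite unitrMr|].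
by rewrite invrM //; apply: F0M_closed.
Qed.

Let units_1 : units F 1.
Proof. by split; rewrite ?invr1 ?unitr1. Qed.

Let units_0_1 : units F0 1.
Proof. by split; rewrite ?invr1 ?unitr1. Qed.

Let kummer_class (s t : H) : set D := coset_of_units F0 (d s t).

(** The cocycle attached to the section [s |-> y_s F^*] is the class of [d]
    itself, so the coboundary relating both is trivial. *)
Lemma graded_kummer_subfield : exists (K : set D) (e : nat),
  [/\ kummer_graded_subfield gr F K e, deg0 gr K = M,
      cl @` gr_support gr K = [set s | s \in R]
    & exists2 alpha : H -> H -> set D, is_alpha gr F cl R K m e alpha
        & same_class (@setmul D) (kum F0 M m) R kummer_class alpha].
Proof.
have [e [kumK y_e]] := kummer_ring_kummer.
exists K, e; split=> //; [exact: kummer_ring_deg0|exact: kummer_ring_support|].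
have mul0 x1 x2 : setmul (coset_of_units F0 x1) (coset_of_units F0 x2) =
    coset_of_units F0 (x1 * x2).
  exact: (setmul_coset _ _ units_0_1 units_mul_F0 units_F0_central).
have mul1 x1 x2 : setmul (coset_of_units F x1) (coset_of_units F x2) =
    coset_of_units F (x1 * x2).
  exact: (setmul_coset _ _ units_1 units_mul_F F_units_central).
have [d1 d2 d3] := d_cocycle.
exists kummer_class.
  split.
    rewrite kummer_ring_deg0; split=> [s t sR tR|s t u sR tR uR|s t sR tR].
    - by exists (d s t) => //; apply: d1.
    - by rewrite /kummer_class !mul0 d2.
    - by rewrite /kummer_class d3.
  exists (fun s => coset_of_units F (y s)); split=> [s sR|s t sR tR].
    have [uy gy cy] := y_homog sR; split; last first.
      by exists (y s), (gam s); split=> //; exists 1; rewrite ?mulr1.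
    exists (y s) => //; split; last exact: y_e.
    split=> //; first exact/kummer_ring_monomial/monomial_y.
    apply/kummer_ring_monomial/monomial_inv; first exact: monomial_y.
    exact: unit_neq0.
  have -> : phi F (kummer_class s t) = coset_of_units F (d s t).
    apply/seteqP; split=> [_ [_ [u Fu <-] [v Fv <-]]|_ [u Fu <-]].
      by exists (u * v); rewrite ?mulrA //; apply: units_mul_F => //; apply: units_F0_F.
    by exists (d s t); [exists 1; rewrite ?mulr1|exists u].
  rewrite !mul1 y_mul //; have [uh _] := h_unit sR tR.
  have [Fh uuh Fhi] := uh.
  have -> : d s t * h s t * y (s * t)%g = d s t * y (s * t)%g * h s t.
    by rewrite -!mulrA (F_central _ Fh).
  apply/seteqP; split=> _ [u Fu <-].
    by exists (h s t * u); rewrite ?mulrA //; apply: units_mul_F.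
  exists ((h s t)^-1 * u); last by rewrite mulrA mulrK.
  by apply: units_mul_F => //; split; rewrite ?unitrV ?invrK.
exists (fun=> coset_of_units F0 1); split=> [s sR|s t sR tR].
  exists 1 => //; split; last by rewrite expr1n.
  by split; rewrite ?invr1 ?unitr1.
by rewrite /kummer_class !mul0 !mulr1.
Qed.
End GradedKummerSubfield.

(** * The factor set of the quotient of supports *)

Lemma coordsP (H : finGroupType) (r : nat) (b : 'I_r -> H) (s : H) :
  is_basis b -> s = (\prod_(i < r) b i ^+ coords b s i)%g.
Proof.
move=> basis.
have [|e [be es _]] := @mem_bigdprod _ _ _ _ [set: H]%G s basis; first by rewrite inE.
have /choice[k Hk] i : exists k, (k < #[b i]%g)%N /\ e i = (b i ^+ k)%g.
  by have [k kb ek] := cyclePmin (be i isT); exists k.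
suff [] : [set m : {ffun 'I_r -> nat} | (forall i, m i < #[b i]%g)%N /\
    s = (\prod_(i < r) b i ^+ m i)%g] (coords b s) by [].
apply: xgetPex; exists (finfun k); split=> [i|]; rewrite ?ffunE; first by case: (Hk i).
by rewrite {1}es; apply: eq_bigr => i _; rewrite ffunE; case: (Hk i).
Qed.

(** The map [cl] is a morphism only on the support; products of homogeneous
    units stay in it. *)
Lemma quotient_prod (Gam : zmodType) (D : unitRingType) (gr : Gam -> set D)
    (GF : set Gam) (H : finGroupType) (cl : Gam -> H) (I : Type) (l : seq I)
    (g : I -> Gam) (u : I -> D) : is_grading gr ->
  is_quotient (gr_support gr [set: D]) GF cl ->
  GF 0 -> (forall i, u i \is a GRing.unit /\ gr (g i) (u i)) ->
  cl (\sum_(i <- l) g i) = (\prod_(i <- l) cl (g i))%g.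
Proof.
move=> Hg [clM _ cl1] GF0 ug.
have unit_neq0 (v : D) : v \is a GRing.unit -> v != 0.
  by apply: contraTneq => ->; rewrite unitr0.
elim: l => [|i l IHl]; rewrite ?big_nil ?big_cons.
  apply/cl1 => //; exists 1; last exact: oner_neq0.
  by split=> //; apply: (gr_one Hg).
rewrite clM ?IHl //.
  by exists (u i); [split=> //; case: (ug i)|apply: unit_neq0; case: (ug i)].
exists (\prod_(j <- l) u j).
  by split=> //; apply: homog_prod => // j; case: (ug j).
by apply: unit_neq0; apply: unitr_prod => j _; case: (ug j).
Qed.

Lemma quotient_muln (Gam : zmodType) (D : unitRingType) (gr : Gam -> set D)
    (GF : set Gam) (H : finGroupType) (cl : Gam -> H) (g : Gam) (u : D) (k : nat) :
  is_grading gr -> is_quotient (gr_support gr [set: D]) GF cl ->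
  GF 0 -> u \is a GRing.unit -> gr g u -> cl (g *+ k) = (cl g ^+ k)%g.
Proof.
move=> Hg Hq GF0 uu gu.
have := quotient_prod (nseq k tt) (g := fun=> g) (u := fun=> u) Hg Hq
  GF0 (fun _ => conj uu gu).
rewrite !big_nseq iter_addr_0 => ->.
by elim: k => // k IHk; rewrite iterS IHk expgS.
Qed.

Theorem theorem2p6
  (Gam : zmodType) (Gam_tf : torsion_free Gam)
  (D : unitRingType) (gr : Gam -> set D) (F : set D)
  (F_gfield : graded_field gr F)
  (D_gcda : graded_central_division_algebra gr F)
  (* H = Gam_D / Gam_F *)
  (H : finGroupType) (cl : Gam -> H)
  (H_quot : is_quotient (gr_support gr [set: D]) (gr_support gr F) cl)
  (* the data defining the factor set (omega, d) *)
  (r : nat) (delta : 'I_r -> Gam)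
  (delta_supp : forall i, gr_support gr [set: D] (delta i))
  (delta_basis : is_basis (fun i => cl (delta i)))
  (x : 'I_r -> D)
  (x_gr : forall i,
     units F (x i) /\ gr (delta i *+ #[cl (delta i)]%g) (x i))
  (z : 'I_r -> D)
  (z_gr : forall i, z i \is a GRing.unit /\ gr (delta i) (z i))
  (* assumption 1 *)
  (M : set D) (m : nat)
  (M_sub : M `<=` deg0 gr [set: D])
  (M_kummer : kummer_field_ext (deg0 gr F) M m)
  (R : {group H})
  (F0_root : contains_prim_root (deg0 gr F) (m * exponent R))
  (* assumption 2 *)
  (d' : H -> H -> D)
  (d'_cocycle : sym_cocycle *%R (KUM (deg0 gr F) M m) R d')
  (omega' : H -> D -> D)
  (omega'_fs : factor_set (deg0 gr [set: D]) (ring_center (deg0 gr [set: D]))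
                 (theta gr cl) R omega' d')
  (omega'_coh : fs_cohomologous (deg0 gr [set: D]) R omega' d'
                  (omega (fun i => cl (delta i)) z)
                  (dfun (fun i => cl (delta i)) x z))
  (omega'_triv : forall s a, s \in R -> M a -> omega' s a = a) :
  exists (K : set D) (n : nat),
    [/\ kummer_graded_subfield gr F K n,
        deg0 gr K = M,
        cl @` gr_support gr K = [set s | s \in R]
      & exists2 alpha : H -> H -> set D,
          is_alpha gr F cl R K m n alpha
        & same_class (@setmul D) (kum (deg0 gr F) M m) R
            (fun s t => coset_of_units (deg0 gr F) (d' s t)) alpha].
Proof.
have [Hg gr_unit FE _] := D_gcda.
have F_central f u : F f -> f * u = u * f by rewrite FE => -[_ ->].
have [F0M _ _] := M_kummer.
have [M_subring MC M_inv [n [c [c_M c_pow c_span]]]] :=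
  kummer_field_ext_spanned M_kummer.
have M_deg0 a : M a -> gr 0 a by move=> /M_sub[].
set b := fun i => cl (delta i) in delta_basis omega'_coh.
case: omega'_coh => a [a_unit a_omega a_d].
have unit_neq0 (v : D) : v \is a GRing.unit -> v != 0.
  by apply: contraTneq => ->; rewrite unitr0.
have [[F1 FB FM] _] : graded_subring gr F by case: F_gfield.
have GF0 : gr_support gr F 0.
  by exists 1; [split=> //; exact: (gr_one Hg)|exact: oner_neq0].
pose zeta s := zpow b z s.
pose gam s := \sum_(i < r) delta i *+ coords b s i.
have zeta_unit s : zeta s \is a GRing.unit.
  by apply: unitr_prod => i _; rewrite unitrX //; case: (z_gr i).
have zeta_gr s : gr (gam s) (zeta s).
  by apply: homog_prod => // i; apply: homog_exp => //; case: (z_gr i).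
have cl_gam s : cl (gam s) = s.
  rewrite (quotient_prod (u := fun i => z i ^+ coords b s i) _ Hg H_quot GF0).
    rewrite [RHS](coordsP s delta_basis); apply: eq_bigr => i _.
    by case: (z_gr i) => uz gz; apply: (quotient_muln _ Hg H_quot GF0 uz gz).
  move=> i; case: (z_gr i) => uz gz; split; first by rewrite unitrX.
  exact: homog_exp.
(* a carries omega' to omega, so its inverse carries zeta to the units that
   induce omega' *)
pose y s := (a s)^-1 * zeta s.
have y_homog s : s \in R ->
    [/\ y s \is a GRing.unit, gr (gam s) (y s) & cl (gam s) = s].
  move=> sR; have [_ ua [_ ga]] := a_unit s sR; split=> //.
    by rewrite unitrMr ?unitrV.
  by rewrite -[gam s]add0r; apply: (gr_mul Hg).
have zetaE s : s \in R -> zeta s = a s * y s.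
  by move=> sR; have [_ ua _] := a_unit s sR; rewrite mulVKr.
have yM s e : s \in R -> M e -> y s * e = e * y s.
  move=> sR Me; have [_ ua _] := a_unit s sR.
  have [uy _ _] := y_homog s sR.
  have := a_omega s e sR (M_sub _ Me); rewrite omega'_triv // /omega -/(zeta s).
  move=> /(congr1 (fun v => (a s)^-1 * v * zeta s)).
  by rewrite !mulrA mulrVK // mulVr // mul1r -!mulrA => ->.
pose h := hfun b x.
pose homog_unit f := units F f /\ exists g, gr g f.
have homog_unit1 : homog_unit 1.
  by split; [split; rewrite ?invr1 ?unitr1|exists 0; exact: (gr_one Hg)].
have homog_unitM f g : homog_unit f -> homog_unit g -> homog_unit (f * g).
  move=> [[Ff uf Ffi] [k fk]] [[Fg ug Fgi] [l gl]]; split.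
    by split; [exact: FM|rewrite unitrMr|rewrite invrM //; exact: FM].
  by exists (k + l); apply: (gr_mul Hg).
have h_unit s t : s \in R -> t \in R -> units F (h s t) /\ exists g, gr g (h s t).
  move=> _ _; apply: (big_ind homog_unit) => // i _.
  elim: (_ %/ _)%N => [|k IHk]; first by rewrite expr0.
  rewrite exprS; apply: homog_unitM => //.
  by have [ux gx] := x_gr i; split=> //; eexists; exact: gx.
have hC s t : h s t = h t s.
  by apply: eq_bigr => i _; rewrite addnC.
have y_mul s t : s \in R -> t \in R -> y s * y t = d' s t * h s t * y (s * t)%g.
  move=> sR tR; have stR : (s * t)%g \in R by rewrite groupM.
  have [_ uas _] := a_unit s sR; have [_ uat _] := a_unit t tR.
  have [_ uast _] := a_unit _ stR.
  have [[Fh uh Fhi] _] := h_unit s t sR tR.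
  have [uys _ _] := y_homog s sR.
  have omega'E v : deg0 gr [set: D] v -> omega' s v = y s * v * (y s)^-1.
    move=> v0; have := a_omega s v sR v0; rewrite /omega -/(zeta s) zetaE //.
    rewrite invrM // !mulrA -!mulrA => /(mulrI uas); rewrite !mulrA.
    have uas' : (a s)^-1 \is a GRing.unit by rewrite unitrV.
    by move=> /(mulIr uas').
  have at0 : deg0 gr [set: D] (a t) by case: (a_unit t tR).
  have := a_d s t sR tR; rewrite /dfun -/(zeta s) -/(zeta t) -/(zeta _) -/(h s t).
  rewrite omega'E // [in LHS]zetaE // [in LHS](zetaE t) // => e.
  have uP : a s * y s * a t \is a GRing.unit.
    by rewrite unitrMr // unitrMr.
  have {}e : y t * ((zeta (s * t)%g)^-1 * (h s t)^-1) =
      (y s)^-1 * (d' s t * (a (s * t)%g)^-1).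
    by apply: (mulrI uP); rewrite !mulrA in e *.
  have ey : y t = (y s)^-1 * (d' s t * (a (s * t)%g)^-1) * (h s t * zeta (s * t)%g).
    by rewrite -e !mulrA mulrVK // mulrVK.
  rewrite ey !mulrA mulrV // mul1r -(mulrA (d' s t)) -(F_central _ _ Fh) !mulrA.
  by rewrite -!mulrA.
exact: (graded_kummer_subfield Gam_tf Hg gr_unit F_gfield F_central H_quot
  M_deg0 F0M M_subring MC M_inv c_M c_pow c_span F0_root d'_cocycle y_homog yM
  h_unit hC y_mul).
Qed.
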